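(* For $q,r\ge0$ let $g_{q,r}$ be the induced hyperkähler metric on the leaf $N_{q,r}$, and let $\kappa_{q,r}:\mathrm{Gr}_2(TN_{q,r})\to\mathbb{R}$ be the sectional curvature of its Levi-Civita connection, viewed as a function on the Grassmannian bundle of tangent $2$-planes. Then: (i) On $N_{0,0}$, the sectional curvature $\kappa_{0,0}$ vanishes identically. (ii) On $N_{q,0}$ with $q>0$, $\kappa_{q,0}$ is a nonconstant function bounded by $\frac{12}{\sqrt q}$, i.e. $|\kappa_{q,0}|\le\frac{12}{\sqrt q}$. (iii) On $N_{q,r}$ with $r>0$ (and $q\ge0$), $\kappa_{q,r}$ is an unbounded function.
   Context: $\langle\cdot,\cdot\rangle$ is the positive definite Ad-invariant inner product on $\mathfrak{su}(2)$ normalized so that $(\mathfrak{su}(2),[\cdot,\cdot],\langle\cdot,\cdot\rangle)\cong(\mathbb{R}^3,\times,\cdot)$, i.e. $\langle x,y\rangle=-2\operatorname{tr}(xy)$. Let $\Phi(a_1,a_2,a_3)=\langle a_1,[a_2,a_3]\rangle$. For $q,r\ge0$, $N_{q,r}$ is the $4$-dimensional submanifold of $\mathfrak{su}(2)^3$ of all $(a_1,a_2,a_3)$ with $\langle a_i,a_j\rangle=0$ for $i\neq j$, $\langle a_1,a_1\rangle-\langle a_2,a_2\rangle=q$, $\langle a_2,a_2\rangle-\langle a_3,a_3\rangle=r$ and $\Phi<0$. It is a symplectic leaf of Xu's hyper-Lie Poisson structure on $\{\Phi\ne0\}\subset\mathfrak{su}(2)^3$, and the induced hyperkähler metric $g_{q,r}$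 is described explicitly as follows: the vector fields $V_0=([a_2,a_3],[a_3,a_1],[a_1,a_2])$, $V_1=(0,[a_2,a_1],[a_3,a_1])$, $V_2=([a_1,a_2],0,[a_3,a_2])$, $V_3=([a_1,a_3],[a_2,a_3],0)$ form a global frame of $TN_{q,r}$, and $g_{q,r}(V_i,V_j)=-\delta_{ij}\Phi$ for $i,j=0,1,2,3$. The sectional curvature is $\kappa(u_1,u_2)=\dfrac{g(R(u_1,u_2)u_2,u_1)}{g(u_1,u_1)g(u_2,u_2)-g(u_1,u_2)^2}$ with $R(U,V)W=\nabla_U\nabla_VW-\nabla_V\nabla_UW-\nabla_{[U,V]}W$. *)

(* Defs.v *)
From HB Require Import structures.
From mathcomp Require Import all_boot all_order all_algebra.
From mathcomp Require Import all_classical all_reals all_analysis.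
From mathcomp Require Import complex ring lra.

Set Implicit Arguments.
Unset Strict Implicit.
Unset Printing Implicit Defensive.

Import Order.TTheory GRing.Theory Num.Theory.
Import numFieldNormedType.Exports.

Local Open Scope classical_set_scope.
Local Open Scope ring_scope.

(** * Calculus on a subset of a normed space *)

Section Smooth.
Variables (R : realType) (V W : normedModType R).
Implicit Types (U N : set V) (f F : V -> W).

(* Meant for open [U].  For finite-dimensional [V], [Ck k U f] says that [f]
   is of class C^k on [U]. *)
Fixpoint Ck (k : nat) U f : Prop :=
  if k is k'.+1 then
    (forall x, U x -> differentiable f x) /\ (forall v, Ck k' U ('D_v f))
  else forall x, U x -> {for x, continuous f}.

Definition local_extension N f (x : V) : set (V -> W) :=
  [set F | exists U, [/\ open U, U x, forall k, Ck k U F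
                       & forall y, N y -> U y -> F y = f y]].

(* Only the values of [f] on [N] matter. *)
Definition smooth_on N f := forall x, N x -> local_extension N f x !=set0.

(* Derivative at [x] in [N] of a map smooth on [N], through a smooth local
   extension; for [v] tangent to [N] it does not depend on the extension. *)
Definition deriv_on N f (x v : V) : W := 'D_v (xget f (local_extension N f x)) x.

End Smooth.

(** * Riemannian geometry of an embedded submanifold [N] of a normed space

    Maps and vector fields on [N] are represented by functions on the ambient
    space, of which only the values on [N] are relevant. *)

Section Riemannian.
Variables (R : realType) (V : normedModType R) (N : set V).

Definition tangent (x : V) : set V :=
  [set v | exists c : R -> V, [/\ c 0 = x, \forall t \near 0, N (c t)
                                & is_derive (0 : R) 1 c v]].

Definition vector_field (X : V -> V) :=
  smooth_on N X /\ forall x, N x -> tangent x (X x).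

(* As the ambient space is a vector space, applying the commutator of
   derivations X(Y f) - Y(X f) to its coordinate functions gives this formula. *)
Definition lie_bracket (X Y : V -> V) : V -> V :=
  fun x => deriv_on N Y x (X x) - deriv_on N X x (Y x).

Definition connection := (V -> V) -> (V -> V) -> (V -> V).

Record is_connection (nabla : connection) : Prop := IsConnection {
  connection_field : forall X Y, vector_field X -> vector_field Y ->
    vector_field (nabla X Y);
  connection_ext : forall X X' Y Y',
    vector_field X -> vector_field X' -> vector_field Y -> vector_field Y' ->
    (forall x, N x -> X x = X' x) -> (forall x, N x -> Y x = Y' x) ->
    forall x, N x -> nabla X Y x = nabla X' Y' x;
  connection_linear : forall (f : V -> R) X X' Y, smooth_on N f ->
    vector_field X -> vector_field X' -> vector_field Y ->
    forall x, N x ->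
      nabla (fun y => f y *: X y + X' y) Y x = f x *: nabla X Y x + nabla X' Y x;
  connection_add : forall X Y Y',
    vector_field X -> vector_field Y -> vector_field Y' ->
    forall x, N x ->
      nabla X (fun y => Y y + Y' y) x = nabla X Y x + nabla X Y' x;
  connection_leibniz : forall (f : V -> R) X Y, smooth_on N f ->
    vector_field X -> vector_field Y ->
    forall x, N x ->
      nabla X (fun y => f y *: Y y) x
        = deriv_on N f x (X x) *: Y x + f x *: nabla X Y x
}.

Definition torsion_free (nabla : connection) :=
  forall X Y, vector_field X -> vector_field Y ->
  forall x, N x -> nabla X Y x - nabla Y X x = lie_bracket X Y x.

Variable g : V -> V -> V -> R. (* [g x u v] is the metric at [x] *)

Definition metric_compatible (nabla : connection) :=
  forall X Y Z, vector_field X -> vector_field Y -> vector_field Z ->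
  forall x, N x ->
    deriv_on N (fun y => g y (Y y) (Z y)) x (X x)
      = g x (nabla X Y x) (Z x) + g x (Y x) (nabla X Z x).

Definition is_levi_civita (nabla : connection) :=
  [/\ is_connection nabla, torsion_free nabla & metric_compatible nabla].

(* [levi_civita] is determined on vector fields and at the points of [N]; its
   remaining values, and the default, are irrelevant. *)
Definition levi_civita : connection :=
  xget (fun _ _ _ => 0) [set nabla | is_levi_civita nabla].

Definition curvature (nabla : connection) (X Y Z : V -> V) : V -> V :=
  fun x => nabla X (nabla Y Z) x - nabla Y (nabla X Z) x
           - nabla (lie_bracket X Y) Z x.

Definition sectional_curvature (nabla : connection) (X Y : V -> V) (x : V) : R :=
  g x (curvature nabla X Y Y x) (X x)
    / (g x (X x) (X x) * g x (Y x) (Y x) - g x (X x) (Y x) ^+ 2).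

End Riemannian.

(** * The Lie algebra su(2) as Euclidean 3-space *)

Section Su2.
Variable R : realType.
Implicit Types x y z : 'rV[R]_3.

Definition o0 : 'I_3 := @Ordinal 3 0 isT.
Definition o1 : 'I_3 := @Ordinal 3 1 isT.
Definition o2 : 'I_3 := @Ordinal 3 2 isT.

Definition dot x y : R := \sum_(k < 3) x 0 k * y 0 k.

Definition cross x y : 'rV[R]_3 :=
  \row_(k < 3) [:: x 0 o1 * y 0 o2 - x 0 o2 * y 0 o1;
                   x 0 o2 * y 0 o0 - x 0 o0 * y 0 o2;
                   x 0 o0 * y 0 o1 - x 0 o1 * y 0 o0]`_k.

(* The identification of R^3 with su(2) given by the basis - i sigma_k / 2,
   where the sigma_k are the Pauli matrices. *)
Definition su2_mx x : 'M[R[i]]_2 :=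
  \matrix_(j < 2, k < 2)
    (nth [::] [:: [:: Complex 0 (- (x 0 o2 / 2));
                      Complex (- (x 0 o1 / 2)) (- (x 0 o0 / 2))];
                  [:: Complex (x 0 o1 / 2) (- (x 0 o0 / 2));
                      Complex 0 (x 0 o2 / 2)]] j)`_k.

(* Skew-Hermitian traceless matrices. *)
Definition is_su2 (A : 'M[R[i]]_2) := map_mx conjc A^T = - A /\ \tr A = 0.

Let mx2P (A B : 'M[R[i]]_2) :
  A 0 0 = B 0 0 -> A 0 1 = B 0 1 -> A 1 0 = B 1 0 -> A 1 1 = B 1 1 -> A = B.
Proof.
move=> h00 h01 h10 h11; apply/matrixP => i j.
have I2 (k : 'I_2) : k = 0 \/ k = 1.
  by case: k => [[|[|k]] hk] //; [left|right]; apply: val_inj.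
by case: (I2 i) => ->; case: (I2 j) => ->.
Qed.

Let row3P x y : x 0 o0 = y 0 o0 -> x 0 o1 = y 0 o1 -> x 0 o2 = y 0 o2 -> x = y.
Proof.
move=> h0 h1 h2; apply/rowP => -[[|[|[|k]]] hk] //.
- by rewrite (_ : Ordinal hk = o0) //; apply: val_inj.
- by rewrite (_ : Ordinal hk = o1) //; apply: val_inj.
- by rewrite (_ : Ordinal hk = o2) //; apply: val_inj.
Qed.

Let complexP (z w : R[i]) :
  complex.Re z = complex.Re w -> complex.Im z = complex.Im w -> z = w.
Proof. by case: z w => a b [c d] /= -> ->. Qed.

Let complexE (z w : R[i]) :
  z = w -> complex.Re z = complex.Re w /\ complex.Im z = complex.Im w.
Proof. by move=> ->. Qed.

Lemma su2_mx_linear (c : R) x y :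
  su2_mx (c *: x + y) = c%:C%C *: su2_mx x + su2_mx y.
Proof. by apply: mx2P; rewrite !mxE /=; apply: complexP => /=; field. Qed.

Lemma su2_mx_inj : injective su2_mx.
Proof.
move=> x y /matrixP e; have := e 0 0; have := e 1 0; rewrite !mxE /=.
have h2 : (2^-1 : R) != 0 by rewrite invr_eq0 pnatr_eq0.
move=> [/(mulIf h2) e1 /oppr_inj/(mulIf h2) e0] [/oppr_inj/(mulIf h2) e2].
exact: row3P.
Qed.

Lemma su2_mx_image (A : 'M[R[i]]_2) : is_su2 A <-> exists x, A = su2_mx x.
Proof.
rewrite /is_su2; split=> [[/matrixP sA tA]|[x ->]]; last first.
  split; first by apply: mx2P; rewrite !mxE /=; apply: complexP => /=; ring.
  by rewrite /mxtrace !big_ord_recl big_ord0 !mxE /=; apply: complexP => /=; ring.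
have := sA 0 0; have := sA 0 1; have := sA 1 1; move: tA.
rewrite /mxtrace !big_ord_recl big_ord0 !mxE /=.
rewrite (_ : lift ord0 ord0 = 1); last exact: val_inj.
case E0 : (A 0 0) => [a b]; case E1 : (A 0 1) => [c d].
case E2 : (A 1 0) => [e f]; case E3 : (A 1 1) => [g h].
move=> /complexE[/= t1 t2] /complexE[/= s1 s2] /complexE[/= s3 s4].
move=> /complexE[/= s5 s6].
exists (\row_(k < 3) [:: - 2 * d; - 2 * c; - 2 * b]`_k).
have a0 : a = 0 by lra.
have g0 : g = 0 by lra.
apply: mx2P; rewrite !mxE /= ?(E0, E1, E2, E3); apply: complexP => /=; lra.
Qed.

Lemma su2_mx_bracket x y :
  su2_mx x *m su2_mx y - su2_mx y *m su2_mx x = su2_mx (cross x y).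
Proof.
by apply: mx2P; rewrite !mxE !big_ord_recl !big_ord0 !mxE /=;
  apply: complexP => /=; field.
Qed.

Lemma su2_mx_dot x y : -2 * \tr (su2_mx x *m su2_mx y) = (dot x y)%:C%C.
Proof.
rewrite /dot !big_ord_recl big_ord0.
rewrite (_ : lift ord0 ord0 = o1); last exact: val_inj.
rewrite (_ : lift ord0 (lift ord0 ord0) = o2); last exact: val_inj.
rewrite (_ : ord0 = o0); last exact: val_inj.
rewrite /mxtrace !big_ord_recl !big_ord0 !mxE !big_ord_recl !big_ord0 !mxE /=.
by apply: complexP => /=; field.
Qed.

End Su2.

(** * The leaves, their frame and their metric *)

Section Leaf.
Variable R : realType.
Local Notation V := 'M[R]_3. (* the rows are the entries a_1, a_2, a_3 *)
Implicit Types (a u v : V) (q r : R).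

Definition Phi a : R := dot (row o0 a) (cross (row o1 a) (row o2 a)).

Definition leaf q r : set V :=
  [set a | [/\ forall i j, i != j -> dot (row i a) (row j a) = 0,
               dot (row o0 a) (row o0 a) - dot (row o1 a) (row o1 a) = q,
               dot (row o1 a) (row o1 a) - dot (row o2 a) (row o2 a) = r
             & Phi a < 0]].

Definition triple (x y z : 'rV[R]_3) : V := \matrix_(i < 3) [:: x; y; z]`_i.

Definition frame a : 4.-tuple V :=
  let a1 := row o0 a in let a2 := row o1 a in let a3 := row o2 a in
  [tuple triple (cross a2 a3) (cross a3 a1) (cross a1 a2);
         triple 0 (cross a2 a1) (cross a3 a1);
         triple (cross a1 a2) 0 (cross a3 a2);
         triple (cross a1 a3) (cross a2 a3) 0].

(* The bilinear form on the span of [frame a] with Gram matrix - Phi a * 1. *)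
Definition leaf_metric a u v : R :=
  \sum_(i < 4) - Phi a * (coord (frame a) i u * coord (frame a) i v).

(* The vector field with constant coefficients in the frame extending [u]. *)
Definition frame_field a u : V -> V :=
  fun b => \sum_(i < 4) coord (frame a) i u *: (frame b)`_i.

(* The Grassmannian bundle of 2-planes tangent to the leaf. *)
Definition Gr2 q r : set (V * {vspace V}) :=
  [set aP | [/\ leaf q r aP.1, \dim aP.2 = 2%N
              & forall u, u \in aP.2 -> tangent (leaf q r) aP.1 u]].

(* The curvature being tensorial, it may be computed from any vector fields
   extending a basis of the plane. *)
Definition kappa q r (aP : V * {vspace V}) : R :=
  let a := aP.1 in let u := (vbasis aP.2)`_0 in let v := (vbasis aP.2)`_1 in
  sectional_curvature (leaf q r) leaf_metric
    (levi_civita (leaf q r) leaf_metric)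
    (frame_field a u) (frame_field a v) a.

End Leaf.

(* Main.v *)
Require Import Defs.
From HB Require Import structures.
From mathcomp Require Import all_boot all_order all_algebra.
From mathcomp Require Import all_classical all_reals all_analysis.
From mathcomp Require Import ring lra.

Import Order.TTheory GRing.Theory Num.Theory.
Import numFieldNormedType.Exports.

Local Open Scope classical_set_scope.
Local Open Scope ring_scope.

Set Implicit Arguments.
Unset Strict Implicit.
Unset Printing Implicit Defensive.

(** The vector fields V_0, ..., V_3 frame the leaf and are conformally
    orthonormal, so the geometry is encoded in their brackets.  Since the rows
    a_1, a_2, a_3 are orthogonal, each cross product of two of them is
    proportional to the third: a_2 x a_3 = w_1 a_1 with w_1 = Phi / |a_1|^2, and
    cyclically.  These three rates govern everything.  Jacobi's identity gives
    [V_0, V_i] = w_i V_i and [V_1, V_2] = - w_3 V_3 (cyclically); the fields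
    V_1, V_2, V_3 rotate the three rows simultaneously and preserve Phi and the
    w_i, while V_0 Phi = (w_1 + w_2 + w_3) Phi and
    V_0 w_i = w_i (w_1 + w_2 + w_3 - 2 w_i).

    It follows that the covariant derivative along V_i acts on the frame as a
    multiple of the i-th quaternionic unit ([leaf_christoffel]); for V_0 this
    unit is the identity, which only accounts for the conformal factor.  So the
    holonomy lies in one factor Sp(1) of SO(4), and the curvature kills one half
    of the 2-forms.  On the other half it is diagonal, with three eigenvalues
    [asd_curvature] / (- Phi) that are explicit in the w_i ([leaf_curvature]).
    As the two halves of the unit bivector of a plane have the same norm,
    the sectional curvature is a convex combination of these eigenvalues
    ([kappaE]).

    The three cases can now be read off.  If q = r = 0, all w_i are equal and
    the eigenvalues vanish.  If r = 0 < q, then w_2 = w_3 and the eigenvalues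
    are c, - c / 2, - c / 2 with c = q / |a_1|^3 ([asd_curvature_EH]): this is
    the Eguchi-Hanson metric, and |a_1| >= sqrt q bounds c.  If r > 0, the third
    row may shrink to 0 while the others do not, and the curvature of the plane
    of V_0 and V_1 then explodes ([kappa_diag_ge]).

    The Levi-Civita connection is given by a choice operator, so it is known
    only through its axioms.  For a manifold with a conformally orthonormal
    frame ([conformal_frame]), the connection with prescribed Christoffel symbols
    is shown to satisfy them ([frame_connection_levi_civita]), and the skewness
    argument behind Koszul's formula shows that nothing else does
    ([levi_civita_unique]). *)

(** * Smooth functions on open sets *)

Section DiffAux.
Variables (R : realType) (V W : normedModType R).

Lemma near_eq_differentiable (f g : V -> W) (x : V) :
  (\near x, f x = g x) -> differentiable f x -> differentiable g x.
Proof.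
move=> fg df; have [dc /eqaddoP dE] := (diff_locallyP _ _).1 df.
have fgx : \forall z \near (0 : V), f (z + x) = g (z + x).
  by move: fg; rewrite (near_shift 0) subr0.
have gE : g \o shift x = cst (g x) + 'd f x +o_ 0 id.
  apply/eqaddoP => e e0; have := dE e e0; apply: filterS2 fgx => z fgz.
  by rewrite /GRing.opp /GRing.add /= -fgz -(nbhs_singleton fg).
by apply/diff_locallyP; rewrite (diff_unique dc gE).
Qed.

(** Scaling is a continuous bilinear map, composed here with the pair (f, g). *)
Lemma diff_scale (f : V -> R) (g : V -> W) x :
  differentiable f x -> differentiable g x ->
  differentiable (fun y => f y *: g y) x /\
  forall v, 'D_v (fun y => f y *: g y) x = 'D_v f x *: g x + f x *: 'D_v g x.
Proof.
move=> df dg.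
have sbil : bilinear_for
    (GRing.Scale.Law.clone _ _ *:%R _) (GRing.Scale.Law.clone _ _ *:%R _)
    (@GRing.scale R W : R^o -> W -> W).
  split=> [u'|u] a y z /=; first by rewrite scalerDl scalerA.
  by rewrite scalerDr !scalerA mulrC.
pose sM := bilinear_isBilinear.Build R R^o W W _ _ (@GRing.scale R W) sbil.
pose sB : {bilinear R^o -> W -> W} := HB.pack (@GRing.scale R W : R^o -> W -> W) sM.
have cB : continuous (fun p : R^o * W => sB p.1 p.2) by exact: scale_continuous.
have dp : differentiable (fun y => (f y : R^o, g y)) x by exact: differentiable_pair.
have dB := @differentiable_bilin _ _ _ _ sB (f x, g x) cB.
have dfg : differentiable (fun y => f y *: g y) x.
  by rewrite (_ : (fun y => _) = (fun p : R^o * W => sB p.1 p.2) \o (fun y => (f y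
    : R^o, g y))) //; exact: differentiable_comp.
split=> // v; rewrite !deriveE //.
rewrite (_ : (fun y => _) = (fun p : R^o * W => sB p.1 p.2) \o (fun y => (f y :
  R^o, g y))) //.
rewrite diff_comp //= diff_pair //=.
have := congr1 (fun h => h ('d f x v, 'd g x v))
  (@diff_bilin _ _ _ _ sB (f x, g x) cB) => /= dBE.
by rewrite [LHS]dBE addrC.
Qed.

End DiffAux.

Section CkTheory.
Variables (R : realType) (V : normedModType R).
Implicit Types (W : normedModType R) (U : set V).

Lemma CkS W k U (f : V -> W) : Ck k.+1 U f -> Ck k U f.
Proof.
elim: k f => [|k IH] f [df Df]; first by move=> x /df/differentiable_continuous.
by split=> // v; apply: IH.
Qed.

Lemma Ck_sub W k U U' (f : V -> W) : U' `<=` U -> Ck k U f -> Ck k U' f.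
Proof.
move=> sU; elim: k f => [|k IH] f /=; first by move=> cf x /sU/cf.
by move=> [df Df]; split=> [x /sU/df|v] //; apply: IH.
Qed.

(** The formulas for the derivatives of sums, products and inverses hold only
    on [U]; as [U] is open this is enough for them to be used in an induction
    on the order of differentiability. *)
Lemma Ck_eq W k U (f g : V -> W) :
  open U -> {in U, f =1 g} -> Ck k U f -> Ck k U g.
Proof.
move=> oU; have nU x : U x -> forall (f g : V -> W), {in U, f =1 g} -> \near x, f x
  = g x.
  move=> Ux f' g' e; have : nbhs x U by apply: open_nbhs_nbhs.
  by apply: filterS => y Uy; apply: e; rewrite inE.
elim: k f g => [|k IH] f g e.
  move=> cf x Ux; have nfg := nU x Ux _ _ e; have := cf x Ux.
  rewrite /prop_for /continuous_at -(nbhs_singleton nfg : f x = g x).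
  by apply: cvg_trans; apply: near_eq_cvg; apply: filterS nfg.
move=> [df Df]; split=> [x Ux|v].
  exact: near_eq_differentiable (nU x Ux _ _ e) (df x Ux).
apply: IH (Df v) => x; rewrite inE => Ux.
exact: near_eq_derive (nU x Ux _ _ e).
Qed.

Lemma Ck_cst W k U (c : W) : Ck k U (cst c).
Proof.
elim: k c => [|k IH] c; first by move=> x _; exact: cst_continuous.
split=> [x _|v]; first exact: differentiable_cst.
by rewrite (_ : 'D_v _ = cst 0) //; apply/funext => x; rewrite derive_cst.
Qed.

Lemma Ck_linear W k U (f : {linear V -> W}) : continuous f -> Ck k U f.
Proof.
move=> cf; case: k => [|k]; first by move=> x _; exact: cf.
split=> [x _|v]; first exact: linear_differentiable.
rewrite (_ : 'D_v _ = cst (f v)); first exact: Ck_cst.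
by apply/funext => x; rewrite deriveE ?diff_lin //; exact: linear_differentiable.
Qed.

Lemma CkD W k U (f g : V -> W) : open U -> Ck k U f -> Ck k U g ->
  Ck k U (fun x => f x + g x).
Proof.
move=> oU; elim: k f g => [|k IH] f g /=.
  by move=> cf cg x Ux; apply: continuousD; [exact: cf|exact: cg].
move=> [df Df] [dg Dg]; split=> [x Ux|v].
  by apply: differentiableD; [exact: df|exact: dg].
apply: Ck_eq (IH _ _ (Df v) (Dg v)) => // x; rewrite inE => Ux.
by rewrite [RHS]deriveD //; apply: diff_derivable; [exact: df|exact: dg].
Qed.

Lemma CkZ W k U (f : V -> R) (g : V -> W) : open U -> Ck k U f -> Ck k U g ->
  Ck k U (fun x => f x *: g x).
Proof.
move=> oU; elim: k f g => [|k IH] f g.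
  by move=> cf cg x Ux; apply: continuousZ; [exact: cf|exact: cg].
move=> Cf Cg; have [df Df] := Cf; have [dg Dg] := Cg; split=> [x Ux|v].
  by have [] := diff_scale (df x Ux) (dg x Ux).
apply: Ck_eq (CkD oU (IH _ _ (Df v) (CkS Cg)) (IH _ _ (CkS Cf) (Dg v))) => // x.
by rewrite inE => Ux; have [_ ->] := diff_scale (df x Ux) (dg x Ux).
Qed.

(** The derivative - f^-2 f' involves 1 / f to one order less, whence the
    induction. *)
Lemma CkV k U (f : V -> R) : open U -> (forall x, U x -> f x != 0) ->
  Ck k U f -> Ck k U (fun x => (f x)^-1).
Proof.
move=> oU f0; elim: k => [|k IH].
  by move=> cf x Ux; apply: continuousV; [exact: f0|exact: cf].
move=> Cf; have [df Df] := Cf; split=> [x Ux|v].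
  by apply: differentiableV; [exact: df|exact: f0].
have CV := IH (CkS Cf).
have CN : Ck k U (cst (-1) : V -> R) by exact: Ck_cst.
have CD : Ck k U ('D_v f) by exact: Df.
apply: Ck_eq (CkZ oU CN (CkZ oU CV (CkZ oU CV CD))) => // x; rewrite inE => Ux.
rewrite deriveV ?f0 //; last exact/diff_derivable/df.
rewrite /GRing.scale /=; rewrite expr2 invfM; ring.
Qed.

Lemma Ck_linear_comp W W' k U (L : {linear W -> W'}) (f : V -> W) :
  continuous L -> open U -> Ck k U f -> Ck k U (L \o f).
Proof.
move=> cL oU; elim: k f => [|k IH] f.
  by move=> cf x Ux; apply: continuous_comp; [exact: cf|exact: cL].
move=> [df Df]; have dL y : differentiable L y by exact: linear_differentiable.
split=> [x Ux|v]; first by apply: differentiable_comp => //; exact: df.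
apply: Ck_eq (IH _ (Df v)) => // x; rewrite inE => Ux.
have dfx := df x Ux; rewrite /= !deriveE //; last exact: differentiable_comp.
by rewrite [in RHS]diff_comp //= diff_lin.
Qed.

Lemma Ck_sum W n k U (f : 'I_n -> V -> W) : open U ->
  (forall i, Ck k U (f i)) -> Ck k U (fun x => \sum_i f i x).
Proof.
move=> oU; elim: n f => [|n IH] f Cf.
  by apply: Ck_eq (Ck_cst k U 0) => // x _; rewrite big_ord0.
apply: Ck_eq (CkD oU (Cf ord0) (IH (fun i => f (lift ord0 i)) _)) => // x _.
by rewrite big_ord_recl.
Qed.

End CkTheory.

(** * Smooth functions and derivatives on a subset *)

Section SmoothOn.
Variables (R : realType) (V : normedModType R) (N : set V).
Implicit Types (W : normedModType R).

Lemma Ck_smooth_on W (f : V -> W) U :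
  open U -> N `<=` U -> (forall k, Ck k U f) -> smooth_on N f.
Proof. by move=> oU NU Cf x /NU Ux; exists f, U. Qed.

Lemma smooth_on_eq W (f g : V -> W) :
  (forall x, N x -> f x = g x) -> smooth_on N f -> smooth_on N g.
Proof.
move=> e sf x Nx; have [F [U [oU Ux CF Ff]]] := sf x Nx.
by exists F, U; split=> // y Ny Uy; rewrite Ff ?e.
Qed.

Lemma smooth_on_cst W (c : W) : smooth_on N (fun=> c).
Proof.
by apply: (@Ck_smooth_on _ _ setT) => // [|k]; [exact: openT|exact: Ck_cst].
Qed.

Lemma smooth_onD W (f g : V -> W) : smooth_on N f -> smooth_on N g ->
  smooth_on N (fun x => f x + g x).
Proof.
move=> sf sg x Nx; have [F [U [oU Ux CF Ff]]] := sf x Nx.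
have [G [U' [oU' Ux' CG Gg]]] := sg x Nx.
have oI : open (U `&` U') by exact: openI.
exists (fun y => F y + G y), (U `&` U'); split=> // [k|y Ny [Uy Uy']].
  by apply: CkD => //; [apply: Ck_sub (CF k)|apply: Ck_sub (CG k)] => y [].
by rewrite Ff ?Gg.
Qed.

Lemma smooth_onZ W (f : V -> R) (g : V -> W) : smooth_on N f -> smooth_on N g ->
  smooth_on N (fun x => f x *: g x).
Proof.
move=> sf sg x Nx; have [F [U [oU Ux CF Ff]]] := sf x Nx.
have [G [U' [oU' Ux' CG Gg]]] := sg x Nx.
have oI : open (U `&` U') by exact: openI.
exists (fun y => F y *: G y), (U `&` U'); split=> // [k|y Ny [Uy Uy']].
  by apply: CkZ => //; [apply: Ck_sub (CF k)|apply: Ck_sub (CG k)] => y [].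
by rewrite Ff ?Gg.
Qed.

Lemma smooth_onM (f g : V -> R) : smooth_on N f -> smooth_on N g ->
  smooth_on N (fun x => f x * g x).
Proof. exact: smooth_onZ. Qed.

Lemma smooth_onN W (f : V -> W) : smooth_on N f -> smooth_on N (fun x => - f x).
Proof.
move=> sf; have s1 : smooth_on N (fun=> -1 : R) by exact: smooth_on_cst.
by apply: smooth_on_eq (smooth_onZ s1 sf) => x _; rewrite scaleN1r.
Qed.

Lemma smooth_onB W (f g : V -> W) : smooth_on N f -> smooth_on N g ->
  smooth_on N (fun x => f x - g x).
Proof. by move=> sf /smooth_onN; exact: smooth_onD. Qed.

Lemma smooth_onV (f : V -> R) : (forall x, N x -> f x != 0) ->
  smooth_on N f -> smooth_on N (fun x => (f x)^-1).
Proof.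
move=> f0 sf x Nx; have [F [U [oU Ux CF Ff]]] := sf x Nx.
have oU0 : open (U `&` [set y | F y != 0]).
  rewrite openE => y [Uy Fy0]; apply: filterI; first exact: open_nbhs_nbhs.
  have cFy : {for y, continuous F} by exact: (CF 0%N).
  apply: (cFy [set z | z != 0]).
  by apply: open_nbhs_nbhs; split=> //; exact: open_neq.
exists (fun y => (F y)^-1), (U `&` [set y | F y != 0]); split=> //.
- by split=> //; rewrite /= Ff ?f0.
- by move=> k; apply: CkV => // [y []//|]; apply: Ck_sub (CF k) => y [].
- by move=> y Ny [Uy _]; rewrite Ff.
Qed.

Lemma smooth_on_sum W n (f : 'I_n -> V -> W) : (forall i, smooth_on N (f i)) ->
  smooth_on N (fun x => \sum_i f i x).
Proof.
elim: n f => [|n IH] f sf.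
  by apply: smooth_on_eq (smooth_on_cst 0) => x _; rewrite big_ord0.
apply: smooth_on_eq (smooth_onD (sf ord0) (IH (fun i => f (lift ord0 i)) _)) => //.
by move=> x _; rewrite big_ord_recl.
Qed.

End SmoothOn.

Section DerivOn.
Variables (R : realType) (V : normedModType R) (N : set V).
Implicit Types (W : normedModType R).

Lemma local_extension_differentiable W (f F : V -> W) x :
  local_extension N f x F -> differentiable F x.
Proof. by move=> [U [oU Ux CF _]]; have [+ _] := CF 1%N; exact. Qed.

(** Along a curve in [N] of velocity [v] the two extensions coincide, and the
    chain rule computes both derivatives from this restriction.  This makes
    [deriv_on] independent of the extension chosen. *)
Lemma tangent_derive_eq W (f F G : V -> W) x v : tangent N x v ->
  local_extension N f x F -> local_extension N f x G -> 'D_v F x = 'D_v G x.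
Proof.
move=> [c [c0 cN dc]] eF eG.
have dF := local_extension_differentiable eF.
have dG := local_extension_differentiable eG.
have dc0 : differentiable c 0 by apply/derivable1_diffP; exact: ex_derive.
have cv : 'd c 0 1 = v by rewrite -deriveE //; exact: derive_val.
have chain (H : V -> W) : differentiable H x -> 'D_v H x = 'D_1 (H \o c) (0 : R).
  rewrite -c0 => dH; rewrite !deriveE //; last exact: differentiable_comp.
  by rewrite [in RHS]diff_comp //= cv.
rewrite !chain //; apply: near_eq_derive.
move: eF eG => [U [oU Ux _ Ff]] [U' [oU' Ux' _ Gf]].
have cc : {for 0, continuous c} by exact: differentiable_continuous.
have nU : \forall t \near (0 : R), (U `&` U') (c t).
  apply: (cc (U `&` U')); rewrite c0; apply: open_nbhs_nbhs.
  by split=> //; exact: openI.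
by apply: filterS2 cN nU => t Nt [Ut Ut'] /=; rewrite Ff ?Gf.
Qed.

Lemma deriv_onE W (f F : V -> W) x v : tangent N x v ->
  local_extension N f x F -> deriv_on N f x v = 'D_v F x.
Proof.
move=> tv eF; have eG := xgetI f eF.
exact: tangent_derive_eq tv eG eF.
Qed.

Lemma local_extension_eq W (f g : V -> W) x : (forall y, N y -> f y = g y) ->
  local_extension N f x = local_extension N g x.
Proof.
move=> e; apply/seteqP; split=> F [U [oU Ux CF Ff]]; exists U; split=> // y Ny Uy.
  by rewrite Ff ?e.
by rewrite Ff ?e.
Qed.

Lemma deriv_on_eq W (f g : V -> W) x v : smooth_on N f ->
  (forall y, N y -> f y = g y) -> N x -> tangent N x v ->
  deriv_on N f x v = deriv_on N g x v.
Proof.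
move=> sf e Nx tv; have [F eF] := sf x Nx.
by rewrite (deriv_onE tv eF) (@deriv_onE _ g F) // -(local_extension_eq x e).
Qed.

Lemma deriv_on_cst W (c : W) x v : tangent N x v ->
  deriv_on N (fun=> c) x v = 0.
Proof.
move=> tv; rewrite (@deriv_onE _ _ (cst c)) ?derive_cst //.
by exists setT; split=> // [|k]; [exact: openT|exact: Ck_cst].
Qed.

Lemma deriv_onD W (f g : V -> W) x v : smooth_on N f -> smooth_on N g -> N x ->
  tangent N x v ->
  deriv_on N (fun y => f y + g y) x v = deriv_on N f x v + deriv_on N g x v.
Proof.
move=> sf sg Nx tv; have [F eF] := sf x Nx; have [G eG] := sg x Nx.
rewrite (deriv_onE tv eF) (deriv_onE tv eG).
have dF := local_extension_differentiable eF.
have dG := local_extension_differentiable eG.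
rewrite (@deriv_onE _ _ (F + G)) //.
  by rewrite deriveD //; exact: diff_derivable.
have [U [oU Ux CF Ff]] := eF; have [U' [oU' Ux' CG Gg]] := eG.
have oI : open (U `&` U') by exact: openI.
exists (U `&` U'); split=> // [k|y Ny [Uy Uy']].
  by apply: CkD => //; [apply: Ck_sub (CF k)|apply: Ck_sub (CG k)] => y [].
by rewrite /GRing.add /= Ff ?Gg.
Qed.

Lemma deriv_onZ W (f : V -> R) (g : V -> W) x v :
  smooth_on N f -> smooth_on N g -> N x -> tangent N x v ->
  deriv_on N (fun y => f y *: g y) x v
    = deriv_on N f x v *: g x + f x *: deriv_on N g x v.
Proof.
move=> sf sg Nx tv; have [F eF] := sf x Nx; have [G eG] := sg x Nx.
rewrite (deriv_onE tv eF) (deriv_onE tv eG).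
have dF := local_extension_differentiable eF.
have dG := local_extension_differentiable eG.
have [U [oU Ux CF Ff]] := eF; have [U' [oU' Ux' CG Gg]] := eG.
rewrite (@deriv_onE _ _ (fun y => F y *: G y)) //.
  by have [_ ->] := diff_scale dF dG; rewrite Ff ?Gg.
have oI : open (U `&` U') by exact: openI.
exists (U `&` U'); split=> // [k|y Ny [Uy Uy']].
  by apply: CkZ => //; [apply: Ck_sub (CF k)|apply: Ck_sub (CG k)] => y [].
by rewrite Ff ?Gg.
Qed.

Lemma deriv_onM (f g : V -> R) x v :
  smooth_on N f -> smooth_on N g -> N x -> tangent N x v ->
  deriv_on N (fun y => f y * g y) x v
    = deriv_on N f x v * g x + f x * deriv_on N g x v.
Proof. exact: deriv_onZ. Qed.

Lemma deriv_on_sum W n (f : 'I_n -> V -> W) x v : (forall i, smooth_on N (f i)) ->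
  N x -> tangent N x v ->
  deriv_on N (fun y => \sum_i f i y) x v = \sum_i deriv_on N (f i) x v.
Proof.
move=> sf Nx tv; elim: n f sf => [|n IH] f sf.
  rewrite big_ord0 -[RHS](@deriv_on_cst _ 0 x v) //.
  apply: deriv_on_eq => //; last by move=> y _; rewrite big_ord0.
  exact: smooth_on_sum.
rewrite big_ord_recl -IH // -deriv_onD //; last exact: smooth_on_sum.
apply: deriv_on_eq => //; first exact: smooth_on_sum.
by move=> y _; rewrite big_ord_recl.
Qed.

Lemma deriv_on_linear W (f : V -> W) x (a : R) u v : smooth_on N f -> N x ->
  tangent N x u -> tangent N x v -> tangent N x (a *: u + v) ->
  deriv_on N f x (a *: u + v) = a *: deriv_on N f x u + deriv_on N f x v.
Proof.
move=> sf Nx tu tv tuv; have [F eF] := sf x Nx.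
rewrite (deriv_onE tu eF) (deriv_onE tv eF) (deriv_onE tuv eF).
have dF := local_extension_differentiable eF.
by rewrite !deriveE // linearP.
Qed.

End DerivOn.

Lemma smooth_on_setT_continuous (R : realType) (V W : normedModType R) (f : V -> W) :
  smooth_on setT f -> continuous f.
Proof.
move=> sf a; have [F eF] := sf a I; have [U [oU Ua _ Ff]] := eF.
have nU : \near a, f a = F a.
  have : nbhs a U by exact: open_nbhs_nbhs.
  by apply: filterS => y Uy; rewrite Ff.
have := differentiable_continuous (local_extension_differentiable eF).
rewrite /prop_for /continuous_at -(nbhs_singleton nU : f a = F a).
by apply: cvg_trans; apply: near_eq_cvg; apply: filterS nU.
Qed.

Lemma matrix_entry_linear (R : realType) m n (i : 'I_m) (j : 'I_n) :
  linear ((fun a => a i j) : 'M[R]_(m, n) -> R).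
Proof. by move=> c a b; rewrite !mxE. Qed.

Lemma Ck_entry (R : realType) (V : normedModType R) m n (f : V -> 'M[R]_(m, n))
    i j k (U : set V) :
  open U -> Ck k U f -> Ck k U (fun x => f x i j).
Proof.
pose sM := GRing.isLinear.Build R 'M[R]_(m, n) R _ _ (matrix_entry_linear i j).
pose L : {linear 'M[R]_(m, n) -> R} := HB.pack ((fun a => a i j) : 'M[R]_(m, n) ->
  R) sM.
exact: (@Ck_linear_comp _ _ _ _ k U L f (@coord_continuous _ _ _ i j)).
Qed.

Lemma smooth_on_entry (R : realType) m n (N : set 'M[R]_(m, n)) i j :
  smooth_on N (fun a => a i j).
Proof.
apply: (@Ck_smooth_on _ _ _ _ _ setT) => // [|k]; first exact: openT.
pose idL : {linear 'M[R]_(m, n) -> 'M[R]_(m, n)} := idfun.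
apply: (@Ck_entry _ _ _ _ id) => //; first exact: openT.
by apply: (@Ck_linear _ _ _ _ _ idL) => x.
Qed.

Lemma smooth_on_comp_entry (R : realType) (V : normedModType R) (N : set V) m n
  (f : V -> 'M[R]_(m, n)) i j : smooth_on N f -> smooth_on N (fun a => f a i j).
Proof.
move=> sf x Nx; have [F [U [oU Ux CF Ff]]] := sf x Nx.
exists (fun y => F y i j), U; split=> // [k|y Ny Uy]; first exact: Ck_entry.
by rewrite Ff.
Qed.

Lemma smooth_on_matrix (R : realType) (V : normedModType R) (N : set V) m n
    (f : V -> 'M[R]_(m, n)) :
  (forall i j, smooth_on N (fun a => f a i j)) -> smooth_on N f.
Proof.
move=> sf.
have: smooth_on N (fun a => \sum_i \sum_j f a i j *: delta_mx i j).
  apply: smooth_on_sum => i; apply: smooth_on_sum => j.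
  by apply: smooth_onZ => //; exact: smooth_on_cst.
by apply: smooth_on_eq => x _; rewrite -matrix_sum_delta.
Qed.

(** The derivative along a varying direction is expanded on the elementary
    matrices: each term is a coordinate of [X] times a derivative of the
    extension of [f] in a fixed direction, and such derivatives are smooth. *)
Lemma smooth_on_deriv_on (R : realType) m n (W : normedModType R)
    (N : set 'M[R]_(m, n)) (f : 'M[R]_(m, n) -> W) (X : 'M[R]_(m, n) -> 'M[R]_(m,
      n)) :
  smooth_on N f -> smooth_on N X -> (forall x, N x -> tangent N x (X x)) ->
  smooth_on N (fun x => deriv_on N f x (X x)).
Proof.
move=> sf sX tX x Nx; have [F [U [oU Ux CF Ff]]] := sf x Nx.
have [G [U' [oU' Ux' CG GX]]] := sX x Nx.
have oI : open (U `&` U') by exact: openI.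
pose H y := \sum_i \sum_j G y i j *: 'D_(delta_mx i j) F y.
exists H, (U `&` U'); split=> //.
  move=> k; apply: Ck_sum => // i; apply: Ck_sum => // j; apply: CkZ => //.
    by apply: Ck_entry => //; apply: Ck_sub (CG k) => y [].
  have CFk : Ck k U ('D_(delta_mx i j) F) by have [_ +] := CF k.+1; exact.
  by apply: Ck_sub CFk => y [].
move=> y Ny [Uy Uy'].
have eF : local_extension N f y F by exists U.
have dF := local_extension_differentiable eF.
rewrite (deriv_onE (tX y Ny) eF) deriveE // -GX // (matrix_sum_delta (G y)).
rewrite linear_sum; apply: eq_bigr => i _; rewrite linear_sum; apply: eq_bigr => j _.
by rewrite linearZ deriveE // (matrix_sum_delta (G y)).
Qed.

(** * The Levi-Civita connection of a conformally orthonormal frame *)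

Section Koszul.
Variables (R : realType) (V : normedModType R) (N : set V).
Variable g : V -> V -> V -> R.
Hypothesis g_sym : forall x u v, g x u v = g x v u.
Hypothesis g_addl : forall x u v w, g x (u + v) w = g x u w + g x v w.

(** The difference of the two connections, as a trilinear form, is symmetric in
    its first two arguments because both are torsion-free, and skew in the last
    two because both are metric; six exchanges show that it equals its opposite. *)
Lemma levi_civita_unique (nabla nabla' : connection V) X Y Z x :
  is_levi_civita N g nabla -> is_levi_civita N g nabla' ->
  vector_field N X -> vector_field N Y -> vector_field N Z -> N x ->
  g x (nabla X Y x) (Z x) = g x (nabla' X Y x) (Z x).
Proof.
move=> [_ T M] [_ T' M'] fX fY fZ Nx.
pose D A B C := g x (nabla A B x) (C x) - g x (nabla' A B x) (C x).
have sym A B C : vector_field N A -> vector_field N B -> D A B C = D B A C.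
  move=> fA fB; have e : nabla A B x + nabla' B A x = nabla' A B x + nabla B A x.
    have tt : nabla A B x - nabla B A x = nabla' A B x - nabla' B A x.
      by rewrite T // T'.
    by rewrite -[nabla A B x](subrK (nabla B A x)) tt addrAC subrK.
  have := congr1 (fun u => g x u (C x)) e; rewrite !g_addl /D; lra.
have skew A B C : vector_field N A -> vector_field N B -> vector_field N C ->
    D A B C = - D A C B.
  move=> fA fB fC; have := M A B C fA fB fC x Nx; rewrite (M' A B C) // /D.
  by rewrite !(g_sym x (B x)); lra.
suff: D X Y Z = 0 by move/eqP; rewrite subr_eq0 => /eqP.
have := skew X Y Z fX fY fZ; have := sym X Z Y fX fZ.
have := skew Z X Y fZ fX fY; have := sym Z Y X fZ fY.
have := skew Y Z X fY fZ fX; have := sym Y X Z fY fX.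
lra.
Qed.

End Koszul.

Section FrameDefinitions.
Variables (R : realType) (m n d : nat).
Local Notation V := 'M[R]_(m, n).
Variables (N : set V) (E : V -> d.-tuple V) (h : V -> R).
Variable Gam : 'I_d -> 'I_d -> 'I_d -> V -> R.

Definition frame_vector (i : 'I_d) : V -> V := fun x => (E x)`_i.
Definition frame_coord i (Y : V -> V) : V -> R := fun x => coord (E x) i (Y x).
Local Notation fr := frame_vector.

Definition conformal_metric (x u v : V) : R :=
  \sum_i h x * (coord (E x) i u * coord (E x) i v).

Definition const_field (u : 'I_d -> R) : V -> V := fun x => \sum_i u i *: fr i x.

(** The k-th coordinate of the covariant derivative along u of v, for u and v of
    constant coordinates in the frame. *)
Definition christoffel_term (u v : 'I_d -> R) k x : R :=
  \sum_i \sum_j u i * v j * Gam i j k x.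

(** The only way to extend the values on the frame by the Leibniz rule. *)
Definition frame_connection : connection V := fun X Y x =>
  \sum_k (deriv_on N (frame_coord k Y) x (X x)
    + christoffel_term (frame_coord^~ X ^~ x) (frame_coord^~ Y ^~ x) k x)
      *: fr k x.

(** [E] is an orthogonal frame all of whose vectors have squared length [h], and
    [Gam i j k] is to be the coordinate along [E_k] of the covariant derivative
    of [E_j] along [E_i]; the last two fields say that torsion-freeness and
    metric compatibility hold on the frame vectors. *)
Record conformal_frame : Prop := ConformalFrame {
  frame_free : forall x, N x -> free (E x);
  frame_tangent : forall x v, N x -> tangent N x v <-> v \in <<E x>>%VS;
  frame_smooth : forall i, smooth_on N (fr i);
  frame_coord_smooth : forall Y i, vector_field N Y ->
    smooth_on N (frame_coord i Y);
  frame_scale_neq0 : forall x, N x -> h x != 0;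
  frame_scale_smooth : smooth_on N h;
  christoffel_smooth : forall i j k, smooth_on N (Gam i j k);
  christoffel_torsion : forall i j x, N x ->
    lie_bracket N (fr i) (fr j) x
      = \sum_k (Gam i j k x - Gam j i k x) *: fr k x;
  christoffel_metric : forall i j k x, N x ->
    deriv_on N h x (fr i x) * (j == k)%:R = h x * (Gam i j k x + Gam i k j x)
}.

End FrameDefinitions.

Section Frame.
Variables (R : realType) (m n d : nat).
Local Notation V := 'M[R]_(m, n).
Variables (N : set V) (E : V -> d.-tuple V) (h : V -> R).
Variable Gam : 'I_d -> 'I_d -> 'I_d -> V -> R.
Hypothesis EhGam : conformal_frame N E h Gam.

Local Notation fr := (frame_vector E).
Local Notation co := (frame_coord E).
Local Notation g := (conformal_metric E h).
Local Notation conn := (frame_connection N E Gam).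
Local Notation chr := (christoffel_term Gam).
Local Notation cf := (const_field E).
Let freeE := frame_free EhGam.
Let tangentE := frame_tangent EhGam.
Let smooth_frame := frame_smooth EhGam.
Let smooth_coord := frame_coord_smooth EhGam.
Let h_neq0 := frame_scale_neq0 EhGam.
Let smooth_h := frame_scale_smooth EhGam.
Let smooth_Gam := christoffel_smooth EhGam.
Let Gam_torsion := christoffel_torsion EhGam.
Let Gam_metric := christoffel_metric EhGam.

Lemma frame_comb_tangent (f : 'I_d -> R) x : N x ->
  tangent N x (\sum_i f i *: fr i x).
Proof.
move=> Nx; apply/tangentE => //; apply: rpred_sum => i _.
by apply/rpredZ/memv_span/mem_nth; rewrite size_tuple.
Qed.

Lemma frame_vector_tangent i x : N x -> tangent N x (fr i x).
Proof.
move=> Nx; apply/tangentE => //.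
by apply/memv_span/mem_nth; rewrite size_tuple.
Qed.

Lemma frame_vector_field i : vector_field N (fr i).
Proof. by split=> // x; exact: frame_vector_tangent. Qed.

Lemma coord_comb (f : 'I_d -> R) k x : N x ->
  coord (E x) k (\sum_i f i *: fr i x) = f k.
Proof. by move=> Nx; rewrite coord_sum_free // freeE. Qed.

Lemma frame_expand v x : N x -> tangent N x v ->
  v = \sum_i coord (E x) i v *: fr i x.
Proof. by move=> Nx /tangentE tv; apply: coord_span; apply: tv. Qed.

Lemma comb_vector_field (f : 'I_d -> V -> R) : (forall i, smooth_on N (f i)) ->
  vector_field N (fun x => \sum_i f i x *: fr i x).
Proof.
move=> sf; split=> [|x Nx]; last exact: frame_comb_tangent.
by apply: smooth_on_sum => i; apply: smooth_onZ.
Qed.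

Lemma tangent_linear (a : R) u v x : N x -> tangent N x u -> tangent N x v ->
  tangent N x (a *: u + v).
Proof.
move=> Nx /tangentE tu /tangentE tv; apply/tangentE => //.
by apply: rpredD; [apply: rpredZ; exact: tu|exact: tv].
Qed.

Lemma christoffel_termPl a u u1 u2 v k x : (forall i, u i = a * u1 i + u2 i) ->
  chr u v k x
    = a * chr u1 v k x + chr u2 v k x.
Proof.
move=> uE; rewrite /christoffel_term mulr_sumr -big_split; apply: eq_bigr => i _.
rewrite mulr_sumr -big_split; apply: eq_bigr => j _ /=.
by rewrite uE; ring.
Qed.

Lemma christoffel_termPr a u v v1 v2 k x : (forall i, v i = a * v1 i + v2 i) ->
  chr u v k x
    = a * chr u v1 k x + chr u v2 k x.
Proof.
move=> vE; rewrite /christoffel_term mulr_sumr -big_split; apply: eq_bigr => i _.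
rewrite mulr_sumr -big_split; apply: eq_bigr => j _ /=.
by rewrite vE; ring.
Qed.

Lemma frame_connection_field X Y : vector_field N X -> vector_field N Y ->
  vector_field N (conn X Y).
Proof.
move=> fX fY; apply: (@comb_vector_field (fun k x => deriv_on N (co k Y) x (X x)
    + chr (co^~ X ^~ x) (co^~ Y ^~ x) k x)) => k.
apply: smooth_onD.
  by apply: smooth_on_deriv_on; [exact: smooth_coord|exact: fX.1|exact: fX.2].
apply: smooth_on_sum => i; apply: smooth_on_sum => j; apply: smooth_onM => //.
by apply: smooth_onM; exact: smooth_coord.
Qed.

Lemma frame_connection_is_connection : is_connection N conn.
Proof.
split.
- exact: frame_connection_field.
- move=> X X' Y Y' fX fX' fY fY' eX eY x Nx; apply: eq_bigr => k _.
  rewrite (@deriv_on_eq _ _ _ _ (co k Y) (co k Y') x) ?eX //.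
  + congr ((_ + _) *: _); apply: eq_bigr => i _; apply: eq_bigr => j _.
    by rewrite /frame_coord eX // eY.
  + exact: smooth_coord.
  + by move=> y Ny; rewrite /frame_coord eY.
  + exact: fX'.2.
- move=> f X X' Y sf fX fX' fY x Nx.
  rewrite /frame_connection scaler_sumr -big_split /=; apply: eq_bigr => k _.
  rewrite scalerA -scalerDl; congr (_ *: _).
  have tX := fX.2 x Nx; have tX' := fX'.2 x Nx.
  rewrite (deriv_on_linear _ Nx tX tX'); last 2 first.
  + exact: smooth_coord.
  + exact: tangent_linear.
  rewrite (christoffel_termPl (a := f x) (u1 := co^~ X ^~ x) (u2 := co^~ X' ^~ x));
    last by move=> i; rewrite /frame_coord linearP.
  by rewrite mulrDr addrACA.
- move=> X Y Y' fX fY fY' x Nx.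
  rewrite /frame_connection -big_split /=; apply: eq_bigr => k _.
  rewrite -scalerDl; congr (_ *: _).
  have cE i y : co i (fun y => Y y + Y' y) y = co i Y y + co i Y' y.
    by rewrite /frame_coord linearD.
  have -> : co k (fun y => Y y + Y' y) = fun y => co k Y y + co k Y' y.
    by apply/funext => y.
  rewrite deriv_onD //; [|exact: smooth_coord|exact: smooth_coord|exact: fX.2].
  rewrite (@christoffel_termPr 1 _ _ (co^~ Y ^~ x) (co^~ Y' ^~ x)) ?mul1r.
    by rewrite addrACA.
  by move=> i; rewrite mul1r.
- move=> f X Y sf fX fY x Nx.
  have {1}-> := frame_expand Nx (fY.2 x Nx).
  rewrite /frame_connection !scaler_sumr -big_split /=; apply: eq_bigr => k _.
  rewrite !scalerA -scalerDl; congr (_ *: _).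
  have cE i y : co i (fun y => f y *: Y y) y = f y * co i Y y.
    by rewrite /frame_coord linearZ.
  have -> : co k (fun y => f y *: Y y) = fun y => f y * co k Y y.
    by apply/funext => y.
  rewrite deriv_onM //; [|exact: smooth_coord|exact: fX.2].
  rewrite (@christoffel_termPr (f x) _ _ (co^~ Y ^~ x) (fun=> 0)).
    rewrite [chr _ (fun=> 0) _ _](_ : _ = 0).
      by rewrite addr0 mulrDr addrA.
    by rewrite /christoffel_term big1 // => i _; rewrite big1 // => j _; rewrite
      mulr0 mul0r.
  by move=> i; rewrite addr0.
Qed.

(** [deriv_on] is linear in tangent directions, being the differential of a
    single extension. *)
Lemma deriv_on_comb (W : normedModType R) (f : V -> W) (c : 'I_d -> R) x :
  N x -> smooth_on N f ->
  deriv_on N f x (\sum_i c i *: fr i x) = \sum_i c i *: deriv_on N f x (fr i x).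
Proof.
move=> Nx sf; have [F eF] := sf x Nx.
have dF := local_extension_differentiable eF.
rewrite (deriv_onE (frame_comb_tangent c Nx) eF) deriveE // linear_sum.
apply: eq_bigr => i _.
by rewrite (deriv_onE (frame_vector_tangent i Nx) eF) deriveE // linearZ.
Qed.

(** The Leibniz rule for Y = sum of y_j E_j along X = sum of x_i E_i. *)
Lemma deriv_on_field X Y x : N x -> vector_field N X -> vector_field N Y ->
  deriv_on N Y x (X x) = \sum_k deriv_on N (co k Y) x (X x) *: fr k x
    + \sum_i \sum_j (co i X x * co j Y x) *: deriv_on N (fr j) x (fr i x).
Proof.
move=> Nx fX fY; have tX := fX.2 x Nx.
have sk k : smooth_on N (fun y => co k Y y *: fr k y).
  by apply: smooth_onZ => //; exact: smooth_coord.
rewrite (@deriv_on_eq _ _ _ _ Y (fun y => \sum_k co k Y y *: fr k y)) //; first last.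
- by move=> y Ny; exact: frame_expand Ny (fY.2 y Ny).
- exact: fY.1.
rewrite deriv_on_sum // exchange_big -big_split; apply: eq_bigr => k _ /=.
rewrite deriv_onZ //; last exact: smooth_coord.
congr (_ + _); rewrite {1}(frame_expand Nx tX) deriv_on_comb // scaler_sumr.
by apply: eq_bigr => i _; rewrite scalerA mulrC.
Qed.

(** The derivatives of the coordinates give the same contribution on both
    sides; what remains is bilinear and reduces to the frame vectors. *)
Lemma frame_connection_torsion_free : torsion_free N conn.
Proof.
move=> X Y fX fY x Nx; rewrite /lie_bracket !deriv_on_field //.
rewrite [X in _ = _ - (_ + X)]exchange_big /=.
rewrite opprD addrACA -!sumrB.
have -> : \sum_i (\sum_j (co i X x * co j Y x) *: deriv_on N (fr j) x (fr i x) -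
      \sum_j (co j Y x * co i X x) *: deriv_on N (fr i) x (fr j x))
    = \sum_i \sum_j \sum_k ((co i X x * co j Y x) * (Gam i j k x - Gam j i k x)) *:
      fr k x.
  apply: eq_bigr => i _; rewrite -sumrB; apply: eq_bigr => j _.
  rewrite [co j Y x * _]mulrC -scalerBr -/(lie_bracket N (fr i) (fr j) x).
  by rewrite Gam_torsion // scaler_sumr; apply: eq_bigr => k _; rewrite scalerA.
rewrite [X in _ = _ + X](_ : _ = \sum_k (chr (co^~ X ^~ x) (co^~ Y ^~ x) k x -
     chr (co^~ Y ^~ x) (co^~ X ^~ x) k x) *: fr k x).
  rewrite -big_split /=; apply: eq_bigr => k _.
  by rewrite -!scalerBl -scalerDl opprD addrACA.
under eq_bigr do rewrite exchange_big /=.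
rewrite exchange_big /=; apply: eq_bigr => k _.
rewrite /christoffel_term [X in _ = (_ - X) *: _]exchange_big -sumrB scaler_suml.
apply: eq_bigr => i _; rewrite -sumrB scaler_suml; apply: eq_bigr => j _ /=.
by rewrite [co j Y x * _]mulrC mulrBr.
Qed.

Lemma frame_connection_metric : metric_compatible N g conn.
Proof.
move=> X Y Z fX fY fZ x Nx; have tX := fX.2 x Nx.
have sY k := smooth_coord k fY; have sZ k := smooth_coord k fZ.
rewrite (_ : (fun y => _) = fun y => \sum_i h y * (co i Y y * co i Z y)) //.
rewrite deriv_on_sum //; last first.
  by move=> i; apply: smooth_onM => //; exact: smooth_onM.
rewrite /conformal_metric.
have nE A B k : N x -> vector_field N A -> vector_field N B ->
    coord (E x) k (conn A B x) = deriv_on N (co k B) x (A x)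
      + chr (co^~ A ^~ x) (co^~ B ^~ x) k x.
  by move=> *; rewrite coord_comb.
have dE k : deriv_on N (fun y => h y * (co k Y y * co k Z y)) x (X x)
    = \sum_i co i X x * deriv_on N h x (fr i x) * (co k Y x * co k Z x)
      + h x * (deriv_on N (co k Y) x (X x) * co k Z x
               + co k Y x * deriv_on N (co k Z) x (X x)).
  rewrite deriv_onM ?deriv_onM //; last exact: smooth_onM.
  by rewrite -mulr_suml {1}(frame_expand Nx tX) deriv_on_comb.
under eq_bigr => k _ do rewrite dE.
rewrite -big_split /=.
under [in RHS]eq_bigr => k _ do rewrite !nE //.
rewrite big_split [RHS](_ : _ = \sum_k (h x *
      (chr (co^~ X ^~ x) (co^~ Y ^~ x) k x * co k Z x)
      + h x * (co k Y x * chr (co^~ X ^~ x) (co^~ Z ^~ x) k x))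
    + \sum_k h x * (deriv_on N (co k Y) x (X x) * co k Z x +
                    co k Y x * deriv_on N (co k Z) x (X x))); last first.
  by rewrite -big_split; apply: eq_bigr => k _ /=; rewrite -/(co k Y x) -/(co k Z
    x); ring.
congr (_ + _); rewrite [RHS]big_split /=.
transitivity (\sum_k \sum_i \sum_j
    (h x * (co i X x * co j Y x * Gam i j k x * co k Z x)
     + h x * (co i X x * co k Z x * Gam i k j x * co j Y x))).
  apply: eq_bigr => k _; apply: eq_bigr => i _.
  transitivity (\sum_j co i X x * co j Y x * co k Z x
                  * (deriv_on N h x (fr i x) * (j == k)%:R)).
    rewrite (bigD1 k) //= eqxx big1 => [|j /negPf ->]; last by rewrite !mulr0.
    by rewrite addr0 mulr1; ring.
  by apply: eq_bigr => j _; rewrite Gam_metric //; ring.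
transitivity (\sum_k \sum_i \sum_j h x * (co i X x * co j Y x * Gam i j k x * co k
  Z x)
  + \sum_k \sum_i \sum_j h x * (co i X x * co k Z x * Gam i k j x * co j Y x)).
  rewrite -big_split; apply: eq_bigr => k _; rewrite -big_split.
  by apply: eq_bigr => i _; rewrite -big_split.
congr (_ + _).
  apply: eq_bigr => k _; rewrite /christoffel_term mulr_suml mulr_sumr.
  by apply: eq_bigr => i _; rewrite mulr_suml mulr_sumr; apply: eq_bigr.
transitivity (\sum_k \sum_j \sum_i
    h x * (co i X x * co k Z x * Gam i k j x * co j Y x)).
  by apply: eq_bigr => k _; rewrite exchange_big.
rewrite exchange_big; apply: eq_bigr => j _; rewrite exchange_big.
rewrite /christoffel_term !mulr_sumr; apply: eq_bigr => i _.
rewrite !mulr_sumr; apply: eq_bigr => k _ /=; ring.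
Qed.

Lemma frame_connection_levi_civita : is_levi_civita N g conn.
Proof.
split; [exact: frame_connection_is_connection|
  exact: frame_connection_torsion_free|exact: frame_connection_metric].
Qed.

Lemma levi_civita_is_levi_civita : is_levi_civita N g (levi_civita N g).
Proof. exact: xgetI frame_connection_levi_civita. Qed.

(** Both connections satisfy the axioms, so they have the same scalar products
    with the frame vectors. *)
Lemma levi_civitaE X Y x : vector_field N X -> vector_field N Y -> N x ->
  levi_civita N g X Y x = conn X Y x.
Proof.
move=> fX fY Nx; have LC := levi_civita_is_levi_civita.
have fL : vector_field N (levi_civita N g X Y).
  by have [[F _ _ _ _] _ _] := LC; exact: F.
rewrite (frame_expand Nx (fL.2 x Nx)); apply: eq_bigr => k _; congr (_ *: _).
have gE v : g x v (fr k x) = h x * coord (E x) k v.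
  rewrite /conformal_metric (bigD1 k) //= big1 => [|j jk].
    by rewrite addr0 coord_free ?freeE // eqxx mulr1.
  by rewrite coord_free ?freeE // eq_sym (negPf jk) !mulr0.
have g_sym y u v : g y u v = g y v u.
  by apply: eq_bigr => j _; rewrite [coord _ _ u * _]mulrC.
have g_addl y u v w : g y (u + v) w = g y u w + g y v w.
  by rewrite -big_split; apply: eq_bigr => j _ /=; rewrite linearD; ring.
have := levi_civita_unique g_sym g_addl LC frame_connection_levi_civita
  fX fY (frame_vector_field k) Nx.
by rewrite !gE => /(mulfI (h_neq0 Nx)) ->; rewrite coord_comb.
Qed.

Lemma levi_civita_field X Y : vector_field N X -> vector_field N Y ->
  vector_field N (levi_civita N g X Y).
Proof.
by move=> fX fY; have [[F _ _ _ _] _ _] := levi_civita_is_levi_civita; exact: F.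
Qed.

Lemma frame_bracketE X Y x : vector_field N X -> vector_field N Y -> N x ->
  lie_bracket N X Y x = \sum_k
    (deriv_on N (co k Y) x (X x) - deriv_on N (co k X) x (Y x)
     + (chr (co^~ X ^~ x) (co^~ Y ^~ x) k x
        - chr (co^~ Y ^~ x) (co^~ X ^~ x) k x)) *: fr k x.
Proof.
move=> fX fY Nx; rewrite -frame_connection_torsion_free // -sumrB.
by apply: eq_bigr => k _; rewrite -scalerBl opprD addrACA.
Qed.

Lemma lie_bracket_field X Y : vector_field N X -> vector_field N Y ->
  vector_field N (lie_bracket N X Y).
Proof.
move=> fX fY; have fXY := frame_connection_field fX fY.
have fYX := frame_connection_field fY fX; split=> [|x Nx].
  apply: smooth_on_eq (smooth_onB fXY.1 fYX.1) => x Nx.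
  by rewrite frame_connection_torsion_free.
by rewrite frame_bracketE //; exact: frame_comb_tangent.
Qed.

(** The inner covariant derivative is known only at the points of [N], hence the
    use of the extensionality axiom for the outer one. *)
Lemma curvature_levi_civitaE X Y Z x : vector_field N X -> vector_field N Y ->
  vector_field N Z -> N x ->
  curvature N (levi_civita N g) X Y Z x = curvature N conn X Y Z x.
Proof.
move=> fX fY fZ Nx; rewrite /curvature.
have [_ ext _ _ _] := frame_connection_is_connection.
have LE A B : vector_field N A -> vector_field N B ->
    levi_civita N g A (levi_civita N g B Z) x = conn A (conn B Z) x.
  move=> fA fB; rewrite levi_civitaE //; last exact: levi_civita_field.
  apply: ext => //; [exact: levi_civita_field|exact: frame_connection_field|].
  by move=> y Ny; rewrite levi_civitaE.
by rewrite !LE // levi_civitaE //; exact: lie_bracket_field.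
Qed.

Lemma const_field_vector_field u : vector_field N (cf u).
Proof. by apply: comb_vector_field => i; exact: smooth_on_cst. Qed.

Lemma coord_const_field u i x : N x -> co i (cf u) x = u i.
Proof. by move=> Nx; rewrite /frame_coord coord_comb. Qed.

Lemma christoffel_term_eq u u' v v' k x : u =1 u' -> v =1 v' ->
  chr u v k x = chr u' v' k x.
Proof.
by move=> eu ev; apply: eq_bigr => i _; apply: eq_bigr => j _; rewrite eu ev.
Qed.

Lemma frame_connection_const X w x : vector_field N X -> N x ->
  conn X (cf w) x
    = \sum_k chr (co^~ X ^~ x) w k x *: fr k x.
Proof.
move=> fX Nx; have tX := fX.2 x Nx; apply: eq_bigr => k _; congr (_ *: _).
have fw := const_field_vector_field w.
rewrite (deriv_on_eq (smooth_coord k fw) (coord_const_field w k)) //.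
rewrite deriv_on_cst // add0r; apply: christoffel_term_eq => // i.
exact: coord_const_field.
Qed.

Lemma coord_frame_connection_const v w k x : N x ->
  co k (conn (cf v) (cf w)) x = chr v w k x.
Proof.
move=> Nx; have fv := const_field_vector_field v.
rewrite /frame_coord frame_connection_const // coord_comb //.
by apply: christoffel_term_eq => // i; exact: coord_const_field.
Qed.

(** The coordinates of the three fields are constant, so the only derivatives
    left are those of the Christoffel symbols. *)
Lemma curvature_constE u v w x : N x ->
  let F a b k := chr a b k x in
  curvature N conn (cf u) (cf v) (cf w) x
    = \sum_k (deriv_on N (chr v w k) x (cf u x)
              - deriv_on N (chr u w k) x (cf v x)
              + (F u (F v w) k - F v (F u w) k
                 - F (fun l => F u v l - F v u l) w k)) *: fr k x.
Proof.
move=> Nx F; have fc a := const_field_vector_field a.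
have ccE a b c : conn (cf a) (conn (cf b) (cf c)) x
    = \sum_k (deriv_on N (chr b c k) x (cf a x)
              + F a (F b c) k) *: fr k x.
  apply: eq_bigr => k _; congr ((_ + _) *: _).
    apply: deriv_on_eq => //; last exact: (fc a).2.
    - exact/smooth_coord/frame_connection_field.
    - by move=> y Ny; rewrite coord_frame_connection_const.
  apply: christoffel_term_eq => i; first exact: coord_const_field.
  exact: coord_frame_connection_const.
rewrite /curvature !ccE frame_connection_const //; last exact: lie_bracket_field.
rewrite -!sumrB; apply: eq_bigr => k _.
rewrite -!scalerBl; congr (_ *: _).
rewrite [X in _ - X = _](@christoffel_term_eq _ (fun l => F u v l - F v u l) _ w) //.
  by rewrite -/(F _ w k); ring.
move=> l; rewrite /frame_coord -frame_connection_torsion_free // linearB /=.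
by congr (_ - _); exact: coord_frame_connection_const.
Qed.

End Frame.

(** * Vector algebra in three dimensions *)

Section VectorAlgebra.
Variable R : realType.
Implicit Types (x y z u : 'rV[R]_3) (a : 'M[R]_3).

Lemma forall_I3 (P : 'I_3 -> Prop) : P o0 -> P o1 -> P o2 -> forall i, P i.
Proof.
move=> P0 P1 P2 [[|[|[|k]]] hk] //.
- by rewrite (_ : Ordinal hk = o0) //; apply: val_inj.
- by rewrite (_ : Ordinal hk = o1) //; apply: val_inj.
- by rewrite (_ : Ordinal hk = o2) //; apply: val_inj.
Qed.

Lemma dotE x y : dot x y = x 0 o0 * y 0 o0 + x 0 o1 * y 0 o1 + x 0 o2 * y 0 o2.
Proof.
rewrite /dot !big_ord_recl big_ord0 addr0 !addrA.
by congr (_ * _ + _ * _ + _ * _); congr (_ _ _); apply: val_inj.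
Qed.

Lemma cross0E x y : cross x y 0 o0 = x 0 o1 * y 0 o2 - x 0 o2 * y 0 o1.
Proof. by rewrite mxE. Qed.

Lemma cross1E x y : cross x y 0 o1 = x 0 o2 * y 0 o0 - x 0 o0 * y 0 o2.
Proof. by rewrite mxE. Qed.

Lemma cross2E x y : cross x y 0 o2 = x 0 o0 * y 0 o1 - x 0 o1 * y 0 o0.
Proof. by rewrite mxE. Qed.

Lemma entryD x y i j : (x + y) i j = x i j + y i j.
Proof. by rewrite mxE. Qed.

Lemma entryN x i j : (- x) i j = - x i j.
Proof. by rewrite mxE. Qed.

Lemma entryZ c x i j : (c *: x) i j = c * x i j.
Proof. by rewrite mxE. Qed.

Lemma entry0 i j : (0 : 'rV[R]_3) i j = 0.
Proof. by rewrite mxE. Qed.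

(** Unlike [mxE], these rules expand only the component asked for, and not the
    whole list of components of each nested cross product. *)
Definition vecE := (cross0E, cross1E, cross2E, entryD, entryN, entryZ, entry0).

Lemma row3P x y : x 0 o0 = y 0 o0 -> x 0 o1 = y 0 o1 -> x 0 o2 = y 0 o2 -> x = y.
Proof. by move=> *; apply/rowP; apply: forall_I3. Qed.

(** The vectors a_2 x a_3, a_3 x a_1, a_1 x a_2 are dual to the rows of [a], up to
    the factor Phi. *)
Lemma cramer a u : Phi a *: u
  = dot u (row o0 a) *: cross (row o1 a) (row o2 a)
  + dot u (row o1 a) *: cross (row o2 a) (row o0 a)
  + dot u (row o2 a) *: cross (row o0 a) (row o1 a).
Proof. by rewrite /Phi !dotE; apply: row3P; rewrite !mxE /=; ring. Qed.

Lemma dotZl (c : R) x y : dot (c *: x) y = c * dot x y.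
Proof. by rewrite !dotE !mxE; ring. Qed.

Lemma dotC x y : dot x y = dot y x.
Proof. by rewrite !dotE; ring. Qed.

Lemma triple_row0 x y z : row o0 (triple x y z) = x.
Proof. by apply/rowP => k; rewrite !mxE. Qed.

Lemma triple_row1 x y z : row o1 (triple x y z) = y.
Proof. by apply/rowP => k; rewrite !mxE. Qed.

Lemma triple_row2 x y z : row o2 (triple x y z) = z.
Proof. by apply/rowP => k; rewrite !mxE. Qed.

Definition triple_rowE := (triple_row0, triple_row1, triple_row2).

Lemma mx3P (a b : 'M[R]_3) : row o0 a = row o0 b -> row o1 a = row o1 b ->
  row o2 a = row o2 b -> a = b.
Proof. by move=> *; apply/row_matrixP; apply: forall_I3. Qed.

End VectorAlgebra.

(** * Derivatives of the polynomial data of the leaf *)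

Section DerivRules.
Variables (R : realType) (m n : nat).
Local Notation V := 'M[R]_(m, n).
Variables (N : set V) (x v : V).
Hypotheses (Nx : N x) (tv : tangent N x v).

(** Smoothness is bundled with the value of the derivative, because each rule for
    the latter requires the former. *)
Definition has_deriv_on (W : normedModType R) (f : V -> W) (l : W) :=
  smooth_on N f /\ deriv_on N f x v = l.

Lemma has_deriv_on_eq (W : normedModType R) (f : V -> W) l l' : has_deriv_on f l ->
  l = l' ->
  has_deriv_on f l'.
Proof. by move=> ? <-. Qed.

Lemma has_deriv_on_cst (c : R) : has_deriv_on (fun=> c) (0 : R).
Proof. by split; [exact: smooth_on_cst|exact: deriv_on_cst]. Qed.

Lemma has_deriv_on_coef i j : has_deriv_on (fun a : V => a i j) (v i j).
Proof.
split; first exact: smooth_on_entry.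
pose sM := GRing.isLinear.Build R V R _ _ (matrix_entry_linear i j).
pose L : {linear V -> R} := HB.pack ((fun a => a i j) : V -> R) sM.
have cL : continuous L by exact: coord_continuous.
rewrite (@deriv_onE _ _ _ _ _ L) //.
  by rewrite deriveE ?diff_lin //; exact: linear_differentiable.
by exists setT; split=> // [|k]; [exact: openT|exact: Ck_linear].
Qed.

Lemma has_deriv_onD (f g : V -> R) lf lg : has_deriv_on f lf ->
  has_deriv_on g lg -> has_deriv_on (fun a => f a + g a) (lf + lg).
Proof. by move=> [sf <-] [sg <-]; split; [exact: smooth_onD|exact: deriv_onD]. Qed.

Lemma has_deriv_onM (f g : V -> R) lf lg : has_deriv_on f lf ->
  has_deriv_on g lg -> has_deriv_on (fun a => f a * g a) (lf * g x + f x * lg).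
Proof. by move=> [sf <-] [sg <-]; split; [exact: smooth_onM|exact: deriv_onM]. Qed.

Lemma has_deriv_onN (f : V -> R) lf : has_deriv_on f lf ->
  has_deriv_on (fun a => - f a) (- lf).
Proof.
move=> df; have := has_deriv_onM (has_deriv_on_cst (-1)) df.
rewrite mul0r add0r mulN1r /has_deriv_on => -[].
by rewrite (_ : (fun a => -1 * f a) = fun a => - f a) // funeqE => a; rewrite mulN1r.
Qed.

(** Obtained by differentiating f / f = 1. *)
Lemma has_deriv_onV (f : V -> R) lf : (forall y, N y -> f y != 0) ->
  has_deriv_on f lf -> has_deriv_on (fun a => (f a)^-1) (- lf / f x ^+ 2).
Proof.
move=> f0 df; have sV := smooth_onV f0 df.1; split=> //.
have [_] := has_deriv_onM df (conj sV erefl).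
rewrite (@deriv_on_eq _ _ _ R _ (fun=> 1 : R)) //; first last.
- by move=> y Ny; rewrite mulfV ?f0.
- by apply: smooth_onM => //; exact: df.1.
rewrite deriv_on_cst // => e; have fx0 := f0 x Nx.
apply: (mulfI fx0); rewrite -[LHS](addKr (lf / f x)) -e addr0.
by field.
Qed.

Lemma has_deriv_on_matrix p q (f : V -> 'M[R]_(p, q)) (l : 'M[R]_(p, q)) :
  (forall i j, has_deriv_on (fun a => f a i j) (l i j)) -> has_deriv_on f l.
Proof.
move=> df; have sf : smooth_on N f by apply: smooth_on_matrix => i j; apply: (df i
  j).1.
split=> //; have [F eF] := sf x Nx; rewrite (deriv_onE tv eF).
have dF := local_extension_differentiable eF.
rewrite derive_mx; last exact: diff_derivable.
apply/matrixP => i j; rewrite mxE -(df i j).2; apply/esym/deriv_onE => //.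
have [U [oU Ux CF Ff]] := eF.
exists U; split=> // [k|y Ny Uy]; first exact: Ck_entry.
by rewrite Ff.
Qed.

End DerivRules.

Section FrameDerivative.
Variable R : realType.
Local Notation V := 'M[R]_3.
Variables (N : set V) (a v : V).
Hypotheses (Na : N a) (tv : tangent N a v).

Lemma has_deriv_on_cross p q k :
  has_deriv_on N a v (fun b => cross (row p b) (row q b) 0 k)
    ((cross (row p v) (row q a) + cross (row p a) (row q v)) 0 k).
Proof.
pose D i j := has_deriv_on_coef tv i j.
pose DM i j i' j' := has_deriv_onM Na tv (D i j) (D i' j').
pose DB i j i' j' i2 j2 i2' j2' :=
  has_deriv_onD Na tv (DM i j i' j') (has_deriv_onN Na tv (DM i2 j2 i2' j2')).
move: k; apply: forall_I3.
- rewrite (_ : (fun _ => _) = fun b : V => b p o1 * b q o2 - b p o2 * b q o1).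
    by apply: has_deriv_on_eq (DB _ _ _ _ _ _ _ _) _; rewrite !vecE !mxE; ring.
  by rewrite funeqE => b; rewrite cross0E !mxE.
- rewrite (_ : (fun _ => _) = fun b : V => b p o2 * b q o0 - b p o0 * b q o2).
    by apply: has_deriv_on_eq (DB _ _ _ _ _ _ _ _) _; rewrite !vecE !mxE; ring.
  by rewrite funeqE => b; rewrite cross1E !mxE.
- rewrite (_ : (fun _ => _) = fun b : V => b p o0 * b q o1 - b p o1 * b q o0).
    by apply: has_deriv_on_eq (DB _ _ _ _ _ _ _ _) _; rewrite !vecE !mxE; ring.
  by rewrite funeqE => b; rewrite cross2E !mxE.
Qed.

Lemma has_deriv_on_dot p q :
  has_deriv_on N a v (fun b => dot (row p b) (row q b))
    (dot (row p v) (row q a) + dot (row p a) (row q v)).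
Proof.
pose D i j := has_deriv_on_coef tv i j.
pose DM i j i' j' := has_deriv_onM Na tv (D i j) (D i' j').
rewrite (_ : (fun _ => _) =
  fun b : V => b p o0 * b q o0 + b p o1 * b q o1 + b p o2 * b q o2); last first.
  by rewrite funeqE => b; rewrite dotE !mxE.
apply: has_deriv_on_eq (has_deriv_onD Na tv (has_deriv_onD Na tv (DM _ _ _ _) (DM _
  _ _ _)) (DM _ _ _ _)) _.
by rewrite !dotE !mxE; ring.
Qed.

Lemma has_deriv_on_Phi :
  has_deriv_on N a v (@Phi R)
    (dot (row o0 v) (cross (row o1 a) (row o2 a))
     + dot (row o1 v) (cross (row o2 a) (row o0 a))
     + dot (row o2 v) (cross (row o0 a) (row o1 a))).
Proof.
pose D i j := has_deriv_on_coef tv i j.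
pose DM j := has_deriv_onM Na tv (D o0 j) (has_deriv_on_cross o1 o2 j).
rewrite (_ : @Phi R = fun b => b o0 o0 * cross (row o1 b) (row o2 b) 0 o0
  + b o0 o1 * cross (row o1 b) (row o2 b) 0 o1
  + b o0 o2 * cross (row o1 b) (row o2 b) 0 o2); last first.
  by rewrite funeqE => b; rewrite /Phi dotE; congr (_ * _ + _ * _ + _ * _); rewrite
    mxE.
apply: has_deriv_on_eq (has_deriv_onD Na tv (has_deriv_onD Na tv (DM _) (DM _)) (DM
  _)) _.
by rewrite !dotE !mxE /=; ring.
Qed.

End FrameDerivative.

(** * The frame of the leaf *)

Section Leaf.
Variable R : realType.
Local Notation V := 'M[R]_3.
Implicit Types a u v : V.

Definition k0 : 'I_4 := @Ordinal 4 0 isT.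
Definition k1 : 'I_4 := @Ordinal 4 1 isT.
Definition k2 : 'I_4 := @Ordinal 4 2 isT.
Definition k3 : 'I_4 := @Ordinal 4 3 isT.

Lemma forall_I4 (P : 'I_4 -> Prop) : P k0 -> P k1 -> P k2 -> P k3 -> forall i, P i.
Proof.
move=> P0 P1 P2 P3 [[|[|[|[|k]]]] hk] //.
- by rewrite (_ : Ordinal hk = k0) //; apply: val_inj.
- by rewrite (_ : Ordinal hk = k1) //; apply: val_inj.
- by rewrite (_ : Ordinal hk = k2) //; apply: val_inj.
- by rewrite (_ : Ordinal hk = k3) //; apply: val_inj.
Qed.

Lemma sum_I4 (W : nmodType) (F : 'I_4 -> W) :
  \sum_i F i = F k0 + F k1 + F k2 + F k3.
Proof.
rewrite !big_ord_recl big_ord0 addr0 !addrA.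
by congr (F _ + F _ + F _ + F _); apply: val_inj.
Qed.

(** The frame is quadratic in [a], and this is its polarization. *)
Definition dframe a v : 4.-tuple V :=
  let dc p q := cross (row p v) (row q a) + cross (row p a) (row q v) in
  [tuple triple (dc o1 o2) (dc o2 o0) (dc o0 o1); triple 0 (dc o1 o0) (dc o2 o0);
         triple (dc o0 o1) 0 (dc o2 o1); triple (dc o0 o2) (dc o1 o2) 0].

Lemma has_deriv_on_frame (N : set V) a v i : N a -> tangent N a v ->
  has_deriv_on N a v (frame_vector (@frame R) i) (dframe a v)`_i.
Proof.
move=> Na tv; apply: has_deriv_on_matrix => // p q.
have congr_deriv (f g : V -> R) l l' : has_deriv_on N a v f l ->
    (forall b, f b = g b) -> l = l' -> has_deriv_on N a v g l'.
  by move=> df fg <-; rewrite -(_ : f = g) //; apply/funext.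
have D p' q' := has_deriv_on_cross Na tv p' q' q.
have D0 := has_deriv_on_cst tv 0.
move: i p; apply: forall_I4; apply: forall_I3.
- by apply: congr_deriv (D o1 o2) _ _ => [b|]; rewrite !mxE.
- by apply: congr_deriv (D o2 o0) _ _ => [b|]; rewrite !mxE.
- by apply: congr_deriv (D o0 o1) _ _ => [b|]; rewrite !mxE.
- by apply: congr_deriv D0 _ _ => [b|]; rewrite !mxE.
- by apply: congr_deriv (D o1 o0) _ _ => [b|]; rewrite !mxE.
- by apply: congr_deriv (D o2 o0) _ _ => [b|]; rewrite !mxE.
- by apply: congr_deriv (D o0 o1) _ _ => [b|]; rewrite !mxE.
- by apply: congr_deriv D0 _ _ => [b|]; rewrite !mxE.
- by apply: congr_deriv (D o2 o1) _ _ => [b|]; rewrite !mxE.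
- by apply: congr_deriv (D o0 o2) _ _ => [b|]; rewrite !mxE.
- by apply: congr_deriv (D o1 o2) _ _ => [b|]; rewrite !mxE.
- by apply: congr_deriv D0 _ _ => [b|]; rewrite !mxE.
Qed.

(** Each coordinate of a tangent vector in the frame can be read off a single
    scalar product: these four forms are dual to the frame, up to the factor
    Phi, for every [a], as shown by [frame_pairing_frame]. *)
Definition frame_pairing (i : 'I_4) a u : R :=
  [:: dot (row o0 u) (row o0 a); dot (row o2 u) (row o1 a);
      dot (row o0 u) (row o2 a); dot (row o1 u) (row o0 a)]`_i.

Lemma frame_pairing_frame (i j : 'I_4) a :
  frame_pairing i a (frame a)`_j = Phi a * (i == j)%:R.
Proof.
move: i j; apply: forall_I4; apply: forall_I4;
  rewrite /frame_pairing /Phi /= ?mulr1n ?mulr0n !dotE !mxE /= ?mxE /=; ring.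
Qed.

Lemma frame_pairing_sum i a (f : 'I_4 -> R) :
  frame_pairing i a (\sum_j f j *: (frame a)`_j) = Phi a * f i.
Proof.
have addP j u v : frame_pairing j a (u + v) = frame_pairing j a u + frame_pairing j
  a v.
  by move: j; apply: forall_I4; rewrite /frame_pairing /= !dotE !mxE; ring.
have scaleP j c u : frame_pairing j a (c *: u) = c * frame_pairing j a u.
  by move: j; apply: forall_I4; rewrite /frame_pairing /= !dotE !mxE; ring.
rewrite !sum_I4 !addP !scaleP !frame_pairing_frame.
by move: i; apply: forall_I4; rewrite /= ?mulr1n ?mulr0n; ring.
Qed.

Lemma frame_freeP a : Phi a != 0 -> free (frame a).
Proof.
move=> P0; apply/freeP => f f0 i; apply: (mulfI P0).
rewrite mulr0 -frame_pairing_sum f0.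
by move: i; apply: forall_I4; rewrite /frame_pairing /= !dotE !mxE; ring.
Qed.

(** The derivative of the i-th row along V_0 is [rate i a] times this row, by
    [leaf_cross]. *)
Definition rate (i : 'I_3) a : R := Phi a / dot (row i a) (row i a).

Variables q r : R.
Local Notation N := (@leaf R q r).

Lemma leaf_dot_gt0 a i : N a -> 0 < dot (row i a) (row i a).
Proof.
move=> [_ _ _ Phi0]; rewrite lt_neqAle eq_sym; apply/andP; split; last first.
  by rewrite /dot; apply: sumr_ge0 => k _; rewrite -expr2 sqr_ge0.
apply/eqP => d0; have ai k : a i k = 0.
  move: d0; rewrite dotE !mxE => d0; apply/eqP; rewrite -sqrf_eq0; apply/eqP.
  have := sqr_ge0 (a i o0); have := sqr_ge0 (a i o1); have := sqr_ge0 (a i o2).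
  by move: k; apply: forall_I3; lra.
move: Phi0; rewrite /Phi !dotE !mxE /=.
by move: i ai {d0}; apply: forall_I3 => ai; rewrite !ai; lra.
Qed.

(** When z is orthogonal to x and y the last two terms vanish, so the cross
    product of x and y is a multiple of z. *)
Lemma cross_sqr (x y z : 'rV[R]_3) : dot z z *: cross x y
  = dot z (cross x y) *: z + dot x z *: cross z y - dot y z *: cross z x.
Proof. by rewrite !dotE; apply: row3P; rewrite !mxE /=; ring. Qed.

Lemma leaf_cross a : N a ->
  [/\ cross (row o1 a) (row o2 a) = rate o0 a *: row o0 a,
      cross (row o2 a) (row o0 a) = rate o1 a *: row o1 a &
      cross (row o0 a) (row o1 a) = rate o2 a *: row o2 a].
Proof.
move=> Na; have [orth _ _ _] := Na.
have key i (w : 'rV[R]_3) : dot (row i a) (row i a) *: w = Phi a *: row i a -> w =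
  rate i a *: row i a.
  move=> e; have d0 := lt0r_neq0 (leaf_dot_gt0 i Na).
  by rewrite /rate mulrC -scalerA -e scalerK.
have tp x y z : dot x (cross y z) = dot y (cross z x).
  by rewrite !dotE !mxE /=; ring.
split; apply: key; rewrite cross_sqr.
- by rewrite -/(Phi a) (orth o1 o0) // (orth o2 o0) // !scale0r addr0 subr0.
- by rewrite -tp -/(Phi a) (orth o2 o1) // (orth o0 o1) // !scale0r addr0 subr0.
- by rewrite tp -/(Phi a) (orth o0 o2) // (orth o1 o2) // !scale0r addr0 subr0.
Qed.

End Leaf.

(** * The tangent space of the leaf *)

Section LeafTangent.
Variables (R : realType) (q r : R).
Local Notation V := 'M[R]_3.
Implicit Types a u v : V.
Local Notation N := (@leaf R q r).

(** The functions defining the leaf are constant on it, so their derivatives in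
    tangent directions vanish. *)
Lemma leaf_tangent_eqs a u : N a -> tangent N a u ->
  [/\ forall i j, i != j -> dot (row i u) (row j a) = - dot (row j u) (row i a),
      dot (row o1 u) (row o1 a) = dot (row o0 u) (row o0 a) &
      dot (row o2 u) (row o2 a) = dot (row o0 u) (row o0 a)].
Proof.
move=> Na tu; have D i j := has_deriv_on_dot Na tu i j.
have const (f : V -> R) l c : has_deriv_on N a u f l -> (forall b, N b -> f b = c)
  -> l = 0.
  by move=> [sf <-] fc; rewrite (deriv_on_eq sf fc) // deriv_on_cst.
have [h01 h12] : dot (row o0 u) (row o0 a) = dot (row o1 u) (row o1 a)
    /\ dot (row o1 u) (row o1 a) = dot (row o2 u) (row o2 a).
  have e1 := const _ _ q (has_deriv_onD Na tu (D o0 o0) (has_deriv_onN Na tu (D o1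
    o1))).
  have e2 := const _ _ r (has_deriv_onD Na tu (D o1 o1) (has_deriv_onN Na tu (D o2
    o2))).
  split.
    have := e1 (fun b Nb => let: And4 _ h _ _ := Nb in h).
    by rewrite !(dotC (row _ a)); lra.
  have := e2 (fun b Nb => let: And4 _ _ h _ := Nb in h).
  by rewrite !(dotC (row _ a)); lra.
split=> [i j ij||]; [|by rewrite h01|by rewrite -h12 h01].
have := const _ _ 0 (D i j) (fun b Nb => let: And4 h _ _ _ := Nb in h i j ij).
by rewrite (dotC (row i a)); lra.
Qed.

Lemma leaf_Phi_neq0 a : N a -> Phi a != 0.
Proof. by move=> [_ _ _ /ltr0_neq0]. Qed.

(** By [cramer], [u] is determined by the nine scalar products of its rows with
    those of [a]; the five equations of [leaf_tangent_eqs] leave four of them,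
    which are those of [frame_pairing]. *)
Lemma leaf_tangent_expand a u : N a -> tangent N a u ->
  u = \sum_i (frame_pairing i a u / Phi a) *: (frame a)`_i.
Proof.
move=> Na tu; have [sk e1 e2] := leaf_tangent_eqs Na tu.
have P0 := leaf_Phi_neq0 Na.
apply: (scalerI P0); rewrite scaler_sumr.
under eq_bigr => i _ do rewrite scalerA mulrC divfK //.
have rowE (b : V) i : row i (Phi a *: b) = Phi a *: row i b by apply/rowP=> j;
  rewrite !mxE.
have rowS p (f : 'I_4 -> V) : row p (\sum_i f i) = \sum_i row p (f i).
  by rewrite linear_sum.
have rowZ p c (b : V) : row p (c *: b) = c *: row p b by rewrite linearZ.
apply: mx3P; rewrite rowE cramer rowS sum_I4 !rowZ /frame_pairing /=.
- by rewrite (sk o0 o1) //; apply: row3P; rewrite !mxE /= ?mxE /=; ring.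
- by rewrite e1 (sk o1 o2) //; apply: row3P; rewrite !mxE /= ?mxE /=; ring.
- by rewrite e2 (sk o2 o0) //; apply: row3P; rewrite !mxE /= ?mxE /=; ring.
Qed.

(** [rot] is conjugation by the quaternion 1 - (t / 2) z: a rotation that is a
    rational function of [t], whose velocity at [t = 0] is the cross product
    with [z]. *)
Lemma rodrigues_dot (t : R) (x y z : 'rV[R]_3) :
  let k := (1 + t ^+ 2 * (dot z z / 4))^-1 in
  let rot (u : 'rV[R]_3) := u + (t * k) *: cross u z + (t ^+ 2 / 2 * k) *: cross
    (cross u z) z in
  dot (rot x) (rot y) = dot x y.
Proof.
move=> k rot.
have d0 : 1 + t ^+ 2 * (dot z z / 4) != 0.
  apply/lt0r_neq0/ltr_wpDr => //; apply: mulr_ge0; first exact: sqr_ge0.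
  by rewrite divr_ge0 // dotE -!expr2 !addr_ge0 // sqr_ge0.
rewrite /rot /k; move: d0; rewrite !dotE !mxE /= => d0.
field.
by apply: contra_neq d0 => e; lra.
Qed.

Lemma Phi_continuous : continuous (@Phi R).
Proof.
apply: smooth_on_setT_continuous.
have t0 : tangent (setT : set V) (0 : V) 0.
  by exists (cst 0); split=> //; [near=> t|exact: is_derive_cst].
by have [] := has_deriv_on_Phi I t0.
Unshelve. all: by end_near. Qed.

(** The combination of V_1, V_2, V_3 with coefficients [f] is an infinitesimal
    rotation of the three rows about this vector. *)
Definition angular_velocity a (f : 'I_4 -> R) : 'rV[R]_3 :=
  f k1 *: row o0 a + f k2 *: row o1 a + f k3 *: row o2 a.

Lemma row_frame_comb a (f : 'I_4 -> R) p : N a ->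
  row p (\sum_i f i *: (frame a)`_i)
    = (f k0 * rate p a) *: row p a + cross (row p a) (angular_velocity a f).
Proof.
move=> Na; have [cr0 cr1 cr2] := leaf_cross Na.
rewrite linear_sum sum_I4 !linearZ -scalerA /angular_velocity /=.
move: p; apply: forall_I3; rewrite -?cr0 -?cr1 -?cr2;
by apply: row3P; rewrite !mxE /= ?mxE /=; ring.
Qed.

(** The curve rotates the three rows about the angular velocity, which preserves
    their scalar products, and rescales them so that their squared norms all
    increase by 2 t (f k0) Phi, which preserves the differences q and r. *)
Lemma leaf_frame_tangent a (f : 'I_4 -> R) : N a ->
  tangent N a (\sum_i f i *: (frame a)`_i).
Proof.
move=> Na; have [orth hq hr Phi0] := Na.
pose z := angular_velocity a f.
pose alpha p := f k0 * rate p a.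
pose k (t : R) := (1 + t ^+ 2 * (dot z z / 4))^-1.
pose rot t (u : 'rV[R]_3) := u + (t * k t) *: cross u z + (t ^+ 2 / 2 * k t) *:
  cross (cross u z) z.
pose g p (t : R) := Num.sqrt (1 + 2 * alpha p * t).
pose c t : V := \matrix_(p < 3) (g p t *: rot t (row p a)).
have c0 : c 0 = a.
  apply/row_matrixP => p; rewrite rowK /g /rot mulr0 addr0 sqrtr1 scale1r.
  by rewrite expr0n /= !mul0r !scale0r !addr0.
have k00 : 1 + 0 ^+ 2 * (dot z z / 4) != 0 by rewrite expr0n mul0r addr0 oner_neq0.
have dD (f1 f2 : R -> R) (l1 l2 : R) : is_derive (0 : R) (1 : R) f1 l1 ->
    is_derive (0 : R) (1 : R) f2 l2 ->
    is_derive (0 : R) 1 (fun t => f1 t + f2 t) (l1 + l2) by exact: is_deriveD.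
have dM (f1 f2 : R -> R) (l1 l2 : R) : is_derive (0 : R) (1 : R) f1 l1 ->
    is_derive (0 : R) (1 : R) f2 l2 ->
    is_derive (0 : R) 1 (fun t => f1 t * f2 t) (f1 0 * l2 + f2 0 * l1).
  exact: is_deriveM.
have dC (b : R) : is_derive (0 : R) 1 (fun=> b) (0 : R) by exact: is_derive_cst.
have dI : is_derive (0 : R) 1 (fun t : R => t) 1 by exact: is_derive_id.
have dlin (b : R) : is_derive (0 : R) 1 (fun t => 1 + b * t) b.
  by apply: is_derive_eq (dD _ _ _ _ (dC 1) (dM _ _ _ _ (dC b) dI)) _; ring.
have dk : is_derive (0 : R) 1 k 0.
  have dq : is_derive (0 : R) 1 (fun t => 1 + t ^+ 2 * (dot z z / 4)) 0.
    apply: is_derive_eq (dD _ _ _ _ (dC 1) (dM _ _ _ _ (dM _ _ _ _ dI dI) (dC _))) _.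
    by ring.
  have dV := @is_deriveV _ (fun t => 1 + t ^+ 2 * (dot z z / 4)) 0 0 1 k00 dq.
  by apply: is_derive_eq dV _; rewrite scaler0.
have k0E : k 0 = 1 by rewrite /k expr0n mul0r addr0 invr1.
have dg p : is_derive (0 : R) 1 (g p) (alpha p).
  have dl := dlin (2 * alpha p).
  have ds : is_derive (1 + 2 * alpha p * 0 : R) 1 Num.sqrt (2 * Num.sqrt 1)^-1.
    by rewrite mulr0 addr0; apply: is_derive1_sqrt.
  have dsl := @is_derive1_comp _ Num.sqrt (fun t => 1 + 2 * alpha p * t) _ _ _ ds dl.
  by apply: is_derive_eq dsl _; rewrite sqrtr1; field.
have g0E p : g p 0 = 1 by rewrite /g mulr0 addr0 sqrtr1.
have combE p := row_frame_comb f p Na.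
have dc : is_derive (0 : R) 1 c (\sum_i f i *: (frame a)`_i).
  have dcE p l : is_derive (0 : R) 1 (fun t => c t p l) (row p (\sum_i f i *:
    (frame a)`_i) 0 l).
    pose A := row p a 0 l; pose P := cross (row p a) z 0 l.
    pose Q := cross (cross (row p a) z) z 0 l.
    have cE : (fun t => c t p l) = fun t => g p t * (A + ((t * k t) * P + (t * t *
      2^-1 * k t) * Q)).
      by rewrite funeqE => t; rewrite mxE mxE /rot 2!mxE [X in _ + X]mxE [X in _ +
        X + _]mxE -addrA.
    rewrite combE -/z -/(alpha p) cE.
    have d1 := dM _ _ _ _ (dM _ _ _ _ dI dk) (dC P).
    have d2 := dM _ _ _ _ (dM _ _ _ _ (dM _ _ _ _ (dM _ _ _ _ dI dI) (dC 2^-1)) dk)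
      (dC Q).
    apply: is_derive_eq (dM _ _ _ _ (dg p) (dD _ _ _ _ (dC A) (dD _ _ _ _ d1 d2))) _.
    by rewrite g0E k0E [RHS]mxE [X in _ = X + _]mxE -/A -/P; ring.
  have der : derivable c 0 1 by apply/derivable_mxP => p l; exact: ex_derive.
  apply: DeriveDef => //; rewrite derive_mx //; apply/matrixP => p l.
  by rewrite mxE derive_val mxE.
exists c; split=> //.
have cc : {for 0, continuous c}.
  by apply: differentiable_continuous; apply/derivable1_diffP; exact: ex_derive.
have cPhi : {for 0, continuous (@Phi R \o c)}.
  by apply: continuous_comp => //; exact: Phi_continuous.
have n1 : \forall t \near (0 : R), Phi (c t) < 0.
  by apply: (cvgr_lt _ cPhi); rewrite /= c0.
have n2 p : \forall t \near (0 : R), 0 < 1 + 2 * alpha p * t.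
  have cl : {for (0 : R), continuous (fun t : R => 1 + 2 * alpha p * t)}.
    apply: differentiable_continuous; apply/derivable1_diffP.
    exact: (@ex_derive _ _ _ _ _ _ _ (dlin (2 * alpha p))).
  by apply: (cvgr_gt _ cl); rewrite mulr0 addr0.
have cdot t i j : dot (row i (c t)) (row j (c t)) = g i t * g j t * dot (row i a)
  (row j a).
  have rd : dot (rot t (row i a)) (rot t (row j a)) = dot (row i a) (row j a).
    exact: rodrigues_dot.
  by rewrite !rowK dotZl (dotC (rot _ _)) dotZl (dotC (rot t (row j a))) rd mulrA.
have gsq t p : 0 < 1 + 2 * alpha p * t -> g p t * g p t * dot (row p a) (row p a)
    = dot (row p a) (row p a) + 2 * f k0 * Phi a * t.
  move=> h; rewrite -expr2 sqr_sqrtr ?ltW // /alpha /rate.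
  by field; exact/lt0r_neq0/(leaf_dot_gt0 p Na).
near=> t; have gs p : g p t * g p t * dot (row p a) (row p a)
    = dot (row p a) (row p a) + 2 * f k0 * Phi a * t.
  apply: gsq; move: p; apply: forall_I3; near: t; exact: n2.
split; last by near: t.
- by move=> i j ij; rewrite cdot orth ?mulr0.
- by rewrite !cdot !gs -hq; ring.
- by rewrite !cdot !gs -hr; ring.
Unshelve. all: by end_near. Qed.

End LeafTangent.

(** * Christoffel symbols of the leaf *)

Section LeafConnection.
Variables (R : realType) (q r : R).
Local Notation V := 'M[R]_3.
Implicit Types a u v : V.
Local Notation N := (@leaf R q r).
Local Notation fr := (frame_vector (@frame R)).

Definition rate_sum a : R := rate o0 a + rate o1 a + rate o2 a.

(** For i = 1, 2, 3 this is (w_i - w_j - w_k) / 2, and for i = 0 it is half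
    the logarithmic derivative of the conformal factor along V_0. *)
Definition connection_rate (i : 'I_4) a : R :=
  [:: rate_sum a / 2; rate o0 a - rate_sum a / 2;
      rate o1 a - rate_sum a / 2; rate o2 a - rate_sum a / 2]`_i.

(** The i-th block has as rows the images of V_0, ..., V_3 under the i-th
    quaternionic unit: for i > 0, it sends V_0 to - V_i, V_i to V_0, and acts on
    the other two as the cross product with V_i. *)
Definition quaternion_unit (i j k : 'I_4) : R :=
  (nth [::] (nth [::]
   [:: [:: [:: 1; 0; 0; 0]; [:: 0; 1; 0; 0]; [:: 0; 0; 1; 0]; [:: 0; 0; 0; 1]];
       [:: [:: 0; -1; 0; 0]; [:: 1; 0; 0; 0]; [:: 0; 0; 0; 1]; [:: 0; 0; -1; 0]];
       [:: [:: 0; 0; -1; 0]; [:: 0; 0; 0; -1]; [:: 1; 0; 0; 0]; [:: 0; 1; 0; 0]];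
       [:: [:: 0; 0; 0; -1]; [:: 0; 0; 1; 0]; [:: 0; -1; 0; 0]; [:: 1; 0; 0; 0]]]
   i) j)`_k.

Definition leaf_christoffel (i j k : 'I_4) a : R :=
  connection_rate i a * quaternion_unit i j k.

Lemma frame_vectorE i a : fr i a = \sum_j (i == j)%:R *: (frame a)`_j.
Proof.
rewrite (bigD1 i) //= eqxx scale1r big1 ?addr0 // => j.
by rewrite eq_sym => /negPf ->; rewrite scale0r.
Qed.

Lemma frame_vector_leaf_tangent a i : N a -> tangent N a (fr i a).
Proof. by move=> Na; rewrite frame_vectorE; exact: leaf_frame_tangent. Qed.

(** Rotations do not change the norms of the rows, and V_0 increases all their
    squares at the same rate. *)
Lemma dot_row_frame_comb a (f : 'I_4 -> R) p : N a ->
  dot (row p (\sum_i f i *: (frame a)`_i)) (row p a) = f k0 * Phi a.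
Proof.
move=> Na; rewrite (row_frame_comb f p Na).
have -> : dot ((f k0 * rate p a) *: row p a + cross (row p a) (angular_velocity a
  f)) (row p a)
    = f k0 * rate p a * dot (row p a) (row p a).
  by rewrite !dotE !mxE /=; ring.
by rewrite /rate; field; exact/lt0r_neq0/(leaf_dot_gt0 p Na).
Qed.

Lemma has_deriv_on_leaf_Phi a (f : 'I_4 -> R) : N a ->
  has_deriv_on N a (\sum_i f i *: (frame a)`_i) (@Phi R)
    (f k0 * rate_sum a * Phi a).
Proof.
move=> Na; have [c0 c1 c2] := leaf_cross Na.
apply: has_deriv_on_eq (has_deriv_on_Phi Na (leaf_frame_tangent f Na)) _.
by rewrite c0 c1 c2 !(dotC _ (_ *: _)) !dotZl !(dotC (row _ a)) !dot_row_frame_comb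
  // /rate_sum; ring.
Qed.

Lemma has_deriv_on_rate a (f : 'I_4 -> R) p : N a ->
  has_deriv_on N a (\sum_i f i *: (frame a)`_i) (@rate R p)
    (f k0 * (rate p a * (rate_sum a - 2 * rate p a))).
Proof.
move=> Na; have tf := leaf_frame_tangent f Na.
have x0 b : N b -> dot (row p b) (row p b) != 0.
  by move=> Nb; exact/lt0r_neq0/(leaf_dot_gt0 p Nb).
have dx := has_deriv_onV Na tf x0 (has_deriv_on_dot Na tf p p).
apply: has_deriv_on_eq (has_deriv_onM Na tf (has_deriv_on_leaf_Phi f Na) dx) _.
rewrite (dotC (row p a) (row p (\sum_i _))) dot_row_frame_comb // /rate.
have := x0 a Na; move: (rate_sum a) (dot _ _) => T x hx; field.
exact: hx.
Qed.

Lemma smooth_on_Phi : smooth_on N (@Phi R).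
Proof.
move=> a Na; have [s _] := has_deriv_on_leaf_Phi (fun=> 0) Na; exact: s.
Qed.

Lemma has_deriv_on_connection_rate a (f : 'I_4 -> R) i : N a ->
  let w p := rate p a * (rate_sum a - 2 * rate p a) in
  let dT := (w o0 + w o1 + w o2) / 2 in
  has_deriv_on N a (\sum_i f i *: (frame a)`_i) (connection_rate i)
    (f k0 * [:: dT; w o0 - dT; w o1 - dT; w o2 - dT]`_i).
Proof.
move=> Na w dT; have tf := leaf_frame_tangent f Na.
have dw p := has_deriv_on_rate f p Na.
have D := has_deriv_onD Na tf; have M := has_deriv_onM Na tf.
have dS := M _ _ _ _ (D _ _ _ _ (D _ _ _ _ (dw o0) (dw o1)) (dw o2))
  (has_deriv_on_cst tf 2^-1).
have dB p := D _ _ _ _ (dw p) (has_deriv_onN Na tf dS).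
move: i; apply: forall_I4.
- by apply: has_deriv_on_eq dS _; rewrite /dT /w /=; ring.
- by apply: has_deriv_on_eq (dB o0) _; rewrite /dT /w /=; ring.
- by apply: has_deriv_on_eq (dB o1) _; rewrite /dT /w /=; ring.
- by apply: has_deriv_on_eq (dB o2) _; rewrite /dT /w /=; ring.
Qed.

Lemma smooth_on_connection_rate i : smooth_on N (connection_rate i).
Proof. by move=> a Na; have [s _] := has_deriv_on_connection_rate (fun=> 0) i Na;
  exact: s. Qed.

Lemma coord_leaf_frame a u i : N a -> tangent N a u ->
  coord (frame a) i u = frame_pairing i a u / Phi a.
Proof.
move=> Na tu; rewrite {1}(leaf_tangent_expand Na tu) coord_sum_free //.
exact: frame_freeP (leaf_Phi_neq0 Na).
Qed.

Lemma smooth_on_leaf_coord (Y : V -> V) i : vector_field N Y ->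
  smooth_on N (frame_coord (@frame R) i Y).
Proof.
move=> [sY tY]; apply: (@smooth_on_eq _ _ _ _ (fun a => frame_pairing i a (Y a) /
  Phi a)).
  by move=> a Na; rewrite /frame_coord coord_leaf_frame //; exact: tY.
apply: smooth_onM; last first.
  by apply: smooth_onV; [move=> a Na; exact: (leaf_Phi_neq0 Na)|exact: smooth_on_Phi].
have sd p p' : smooth_on N (fun a => dot (row p (Y a)) (row p' a)).
  apply: smooth_on_sum => l; apply: smooth_onM.
    by apply: smooth_on_eq (smooth_on_comp_entry p l sY) => a _; rewrite mxE.
  by apply: smooth_on_eq (@smooth_on_entry _ _ _ _ p' l) => a _; rewrite mxE.
by move: i; apply: forall_I4; [exact: (sd o0 o0)|exact: (sd o2 o1)|
  exact: (sd o0 o2)|exact: (sd o1 o0)].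
Qed.

(** Once w_i a_i is replaced by the cross product of the other two rows, the
    bracket relations become identities between iterated cross products of three
    arbitrary vectors. *)
Lemma leaf_bracket i j a : N a ->
  lie_bracket N (fr i) (fr j) a
    = \sum_k (leaf_christoffel i j k a - leaf_christoffel j i k a) *: fr k a.
Proof.
move=> Na.
have dE l l' : deriv_on N (fr l) a (fr l' a) = (dframe a (fr l' a))`_l.
  by have [] := has_deriv_on_frame l Na (frame_vector_leaf_tangent l' Na).
rewrite /lie_bracket !dE.
pose F l l' := (dframe a (fr l a))`_l'.
suff FE (l l' : 'I_4) : (l < l')%N -> F l l' - F l' l
    = \sum_k (leaf_christoffel l l' k a - leaf_christoffel l' l k a) *: fr k a.
  have [/FE//|ji|/val_inj->] := ltngtP i j; last first.
    by rewrite subrr big1 // => k _; rewrite subrr scale0r.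
  rewrite -opprB FE // -sumrN; apply: eq_bigr => k _.
  by rewrite -scaleNr opprB.
have [c0 c1 c2] := leaf_cross Na.
(* The row that vanishes in the frame vector is written as the cross product of
   a row with a multiple of itself, which it becomes in the bracket. *)
have s0 : rate o0 a *: fr k1 a
    = triple (cross (row o0 a) (rate o0 a *: row o0 a)) (cross (row o1 a) (rate o0
      a *: row o0 a)) (cross (row o2 a) (rate o0 a *: row o0 a)).
  by rewrite /frame_vector; apply: mx3P; apply: row3P; rewrite !mxE /= ?mxE /=; ring.
have s1 : rate o1 a *: fr k2 a
    = triple (cross (row o0 a) (rate o1 a *: row o1 a)) (cross (row o1 a) (rate o1
      a *: row o1 a)) (cross (row o2 a) (rate o1 a *: row o1 a)).
  by rewrite /frame_vector; apply: mx3P; apply: row3P; rewrite !mxE /= ?mxE /=; ring.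
have s2 : rate o2 a *: fr k3 a
    = triple (cross (row o0 a) (rate o2 a *: row o2 a)) (cross (row o1 a) (rate o2
      a *: row o2 a)) (cross (row o2 a) (rate o2 a *: row o2 a)).
  by rewrite /frame_vector; apply: mx3P; apply: row3P; rewrite !mxE /= ?mxE /=; ring.
have F01 : F k0 k1 - F k1 k0 = rate o0 a *: fr k1 a.
  rewrite s0 -c0 /F /frame_vector /= !triple_rowE;
    apply: mx3P; rewrite linearB /= !triple_rowE;
    move: (row o0 a) (row o1 a) (row o2 a) => x y z; apply: row3P; rewrite !vecE;
      ring.
have F02 : F k0 k2 - F k2 k0 = rate o1 a *: fr k2 a.
  rewrite s1 -c1 /F /frame_vector /= !triple_rowE;
    apply: mx3P; rewrite linearB /= !triple_rowE;
    move: (row o0 a) (row o1 a) (row o2 a) => x y z; apply: row3P; rewrite !vecE;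
      ring.
have F03 : F k0 k3 - F k3 k0 = rate o2 a *: fr k3 a.
  rewrite s2 -c2 /F /frame_vector /= !triple_rowE;
    apply: mx3P; rewrite linearB /= !triple_rowE;
    move: (row o0 a) (row o1 a) (row o2 a) => x y z; apply: row3P; rewrite !vecE;
      ring.
have F12 : F k2 k1 - F k1 k2 = rate o2 a *: fr k3 a.
  rewrite s2 -c2 /F /frame_vector /= !triple_rowE;
    apply: mx3P; rewrite linearB /= !triple_rowE;
    move: (row o0 a) (row o1 a) (row o2 a) => x y z; apply: row3P; rewrite !vecE;
      ring.
have F13 : F k1 k3 - F k3 k1 = rate o1 a *: fr k2 a.
  rewrite s1 -c1 /F /frame_vector /= !triple_rowE;
    apply: mx3P; rewrite linearB /= !triple_rowE;
    move: (row o0 a) (row o1 a) (row o2 a) => x y z; apply: row3P; rewrite !vecE;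
      ring.
have F23 : F k3 k2 - F k2 k3 = rate o0 a *: fr k1 a.
  rewrite s0 -c0 /F /frame_vector /= !triple_rowE;
    apply: mx3P; rewrite linearB /= !triple_rowE;
    move: (row o0 a) (row o1 a) (row o2 a) => x y z; apply: row3P; rewrite !vecE;
      ring.
move: l l'; do 2! apply: forall_I4; move=> // _;
rewrite ?(F01, F02, F03, F13) -?[F k1 k2 - _]opprB -?[F k2 k3 - _]opprB ?(F12, F23)
  sum_I4 /leaf_christoffel /connection_rate /rate_sum;
move: (rate o0 a) (rate o1 a) (rate o2 a) (fr k0 a) (fr k1 a) (fr k2 a) (fr k3 a)
  => w0 w1 w2 x0 x1 x2 x3;
apply/matrixP => x y; by rewrite !mxE /quaternion_unit /=; field.
Qed.

Lemma leaf_conformal_frame :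
  conformal_frame N (@frame R) (fun a => - Phi a) leaf_christoffel.
Proof.
split.
- by move=> a Na; exact: frame_freeP (leaf_Phi_neq0 Na).
- move=> a u Na; split=> [tu|/coord_span ->]; last exact: leaf_frame_tangent.
  rewrite (leaf_tangent_expand Na tu); apply: rpred_sum => i _.
  by apply/rpredZ/memv_span/mem_nth; rewrite size_tuple.
- move=> i a Na; have [s _] := has_deriv_on_frame i Na (frame_vector_leaf_tangent i
  Na).
  exact: s.
- by move=> Y i; exact: smooth_on_leaf_coord.
- by move=> a Na; rewrite oppr_eq0 (leaf_Phi_neq0 Na).
- exact/smooth_onN/smooth_on_Phi.
- move=> i j k; apply: smooth_onM; first exact: smooth_on_connection_rate.
  exact: smooth_on_cst.
- exact: leaf_bracket.
- move=> i j k a Na; rewrite {1}frame_vectorE.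
  have [_ ->] := has_deriv_onN Na (leaf_frame_tangent _ Na) (has_deriv_on_leaf_Phi
    (fun j => (i == j)%:R) Na).
  move: i j k; do 3! apply: forall_I4; rewrite /leaf_christoffel /connection_rate
    /quaternion_unit /=; by rewrite ?mulr1n ?mulr0n; field.
Qed.

End LeafConnection.

(** * Curvature of the leaf *)

Section LeafCurvature.
Variables (R : realType) (q r : R).
Local Notation V := 'M[R]_3.
Implicit Types a : V.
Implicit Types u v w : 'I_4 -> R.
Local Notation N := (@leaf R q r).
Local Notation E := (@frame R).
Local Notation chr := (christoffel_term (@leaf_christoffel R)).

(** The quaternionic units, weighted by the [b i * u i], applied to [v]. *)
Definition quaternion_action (b u v : 'I_4 -> R) (k : 'I_4) : R :=
  [:: b k0 * u k0 * v k0 + b k1 * u k1 * v k1 + b k2 * u k2 * v k2 + b k3 * u k3 * v k3;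
      b k0 * u k0 * v k1 - b k1 * u k1 * v k0 + b k2 * u k2 * v k3 - b k3 * u k3 * v k2;
      b k0 * u k0 * v k2 - b k1 * u k1 * v k3 - b k2 * u k2 * v k0 + b k3 * u k3 * v k1;
      b k0 * u k0 * v k3 + b k1 * u k1 * v k2 - b k2 * u k2 * v k1 - b k3 * u k3 * v k0]`_k.

Lemma leaf_christoffel_term u v k a :
  chr u v k a = quaternion_action (fun i => connection_rate i a) u v k.
Proof.
rewrite /christoffel_term !sum_I4 /leaf_christoffel /quaternion_action.
move: k; apply: forall_I4; rewrite /quaternion_unit /=; ring.
Qed.

Definition connection_rate_deriv a (i : 'I_4) : R :=
  let w p := rate p a * (rate_sum a - 2 * rate p a) in
  let dT := (w o0 + w o1 + w o2) / 2 in
  [:: dT; w o0 - dT; w o1 - dT; w o2 - dT]`_i.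

Lemma has_deriv_on_leaf_christoffel_term a u v w k : N a ->
  has_deriv_on N a (const_field E u a) (chr v w k)
    (quaternion_action (fun i => u k0 * connection_rate_deriv a i) v w k).
Proof.
move=> Na; have tu : tangent N a (const_field E u a) by exact: leaf_frame_tangent.
have -> : chr v w k = fun b => quaternion_action (fun i => connection_rate i b) v w k.
  by apply/funext => b; exact: leaf_christoffel_term.
have dB i := has_deriv_on_connection_rate u i Na.
have dC c := has_deriv_on_cst tu c.
have D := has_deriv_onD Na tu; have S := has_deriv_onN Na tu.
have M i i' j := has_deriv_onM Na tu (has_deriv_onM Na tu (dB i) (dC (v i'))) (dC
  (w j)).
move: k; apply: forall_I4; rewrite /quaternion_action /=.
- apply: has_deriv_on_eq (D _ _ _ _ (D _ _ _ _ (D _ _ _ _ (M _ _ _) (M _ _ _)) (M _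
  _ _)) (M _ _ _)) _.
  by rewrite /connection_rate_deriv /=; ring.
- apply: has_deriv_on_eq (D _ _ _ _ (D _ _ _ _ (D _ _ _ _ (M _ _ _) (S _ _ (M _ _
  _))) (M _ _ _)) (S _ _ (M _ _ _))) _.
  by rewrite /connection_rate_deriv /=; ring.
- apply: has_deriv_on_eq (D _ _ _ _ (D _ _ _ _ (D _ _ _ _ (M _ _ _) (S _ _ (M _ _
  _))) (S _ _ (M _ _ _))) (M _ _ _)) _.
  by rewrite /connection_rate_deriv /=; ring.
- apply: has_deriv_on_eq (D _ _ _ _ (D _ _ _ _ (D _ _ _ _ (M _ _ _) (M _ _ _)) (S _
  _ (M _ _ _))) (S _ _ (M _ _ _))) _.
  by rewrite /connection_rate_deriv /=; ring.
Qed.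

(** An eigenvalue of the curvature operator on the 2-forms [asd_part], times the
    factor - Phi. *)
Definition rate_curvature (x y z : R) : R :=
  ((y - z) ^+ 2 - 2 * x ^+ 2 + x * (y + z)) / 2.

(** Three coordinates of the component of the bivector of [u] and [v] in the half
    of the 2-forms that the curvature of a hyperkaehler metric does not kill. *)
Definition asd_part u v (i : 'I_3) : R :=
  [:: (u k0 * v k1 - u k1 * v k0) - (u k2 * v k3 - u k3 * v k2);
      (u k0 * v k2 - u k2 * v k0) - (u k3 * v k1 - u k1 * v k3);
      (u k0 * v k3 - u k3 * v k0) - (u k1 * v k2 - u k2 * v k1)]`_i.

Lemma conformal_metric_comb a u v : N a ->
  conformal_metric E (fun b => - Phi b) a (const_field E u a) (const_field E v a)
    = - Phi a * (u k0 * v k0 + u k1 * v k1 + u k2 * v k2 + u k3 * v k3).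
Proof.
move=> Na; rewrite /conformal_metric sum_I4.
have EF := leaf_conformal_frame q r.
by rewrite !(coord_comb EF _ _ Na); ring.
Qed.

(** The units anticommute and the symbols are multiples of them, so the curvature
    of V_0 and V_i, or of V_j and V_k, is a multiple of the i-th unit; the two
    multiples are opposite, and this makes the curvature a function of
    [asd_part]. *)
Lemma leaf_curvature a u v : N a ->
  conformal_metric E (fun b => - Phi b) a
    (curvature N (levi_civita N (@leaf_metric R))
       (const_field E u) (const_field E v) (const_field E v) a) (const_field E u a)
  = - Phi a *
    (rate_curvature (rate o0 a) (rate o1 a) (rate o2 a) * asd_part u v o0 ^+ 2
     + rate_curvature (rate o1 a) (rate o2 a) (rate o0 a) * asd_part u v o1 ^+ 2
     + rate_curvature (rate o2 a) (rate o0 a) (rate o1 a) * asd_part u v o2 ^+ 2).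
Proof.
move=> Na; have EF := leaf_conformal_frame q r.
have fc w : vector_field N (const_field E w) by exact: const_field_vector_field EF w.
rewrite (curvature_levi_civitaE EF (fc u) (fc v) (fc v) Na).
rewrite (curvature_constE EF u v v Na).
set K := (X in \sum_k X k *: _).
rewrite (conformal_metric_comb (fun k => K k) u Na); congr (_ * _).
have dE w w' w'' k : deriv_on N (chr w' w'' k) a (const_field E w a)
    = quaternion_action (fun i => w k0 * connection_rate_deriv a i) w' w'' k.
  by have [] := has_deriv_on_leaf_christoffel_term w w' w'' k Na.
have cE w w' k : chr w w' k a = quaternion_action (fun i => connection_rate i a) w
  w' k.
  exact: leaf_christoffel_term.
rewrite /K !dE !cE /quaternion_action /= !cE /quaternion_action /=.
rewrite /connection_rate_deriv /asd_part /rate_curvature /connection_rate /rate_sum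
  /=.
move: (rate o0 a) (rate o1 a) (rate o2 a) => x y z.
move: (u k0) (u k1) (u k2) (u k3) (v k0) (v k1) (v k2) (v k3).
move=> u0 u1 u2 u3 v0 v1 v2 v3.
by field.
Qed.

End LeafCurvature.

(** * Sectional curvature of planes *)

Section Planes.
Variables (R : realType) (q r : R).
Local Notation V := 'M[R]_3.
Implicit Types a : V.
Local Notation N := (@leaf R q r).
Local Notation E := (@frame R).

Definition asd_curvature a (i : 'I_3) : R :=
  [:: rate_curvature (rate o0 a) (rate o1 a) (rate o2 a);
      rate_curvature (rate o1 a) (rate o2 a) (rate o0 a);
      rate_curvature (rate o2 a) (rate o0 a) (rate o1 a)]`_i.

Definition basis_coord (aP : V * {vspace V}) (n : nat) (i : 'I_4) : R :=
  coord (frame aP.1) i (vbasis aP.2)`_n.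

Lemma sum_I3 (W : nmodType) (F : 'I_3 -> W) : \sum_i F i = F o0 + F o1 + F o2.
Proof.
rewrite !big_ord_recl big_ord0 addr0 !addrA.
by congr (F _ + F _ + F _); apply: val_inj.
Qed.

(** By the Pluecker relation, the squared area of the parallelogram of [u] and [v]
    is the sum of the squares of [asd_part], up to the factor Phi ^+ 2. *)
Lemma kappaE aP : leaf q r aP.1 ->
  kappa q r aP = (\sum_i asd_curvature aP.1 i
                    * asd_part (basis_coord aP 0) (basis_coord aP 1) i ^+ 2)
    / (- Phi aP.1 * \sum_i asd_part (basis_coord aP 0) (basis_coord aP 1) i ^+ 2).
Proof.
move=> Na; have h0 : - Phi aP.1 != 0 by rewrite oppr_eq0 (leaf_Phi_neq0 Na).
set u := basis_coord aP 0; set v := basis_coord aP 1.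
rewrite /kappa /sectional_curvature.
rewrite [X in X / _](leaf_curvature u v Na).
have M w w' : leaf_metric aP.1 (const_field E w aP.1) (const_field E w' aP.1)
    = - Phi aP.1 * (w k0 * w' k0 + w k1 * w' k1 + w k2 * w' k2 + w k3 * w' k3).
  exact: conformal_metric_comb Na.
rewrite [X in _ / X](_ : _ = - Phi aP.1 * (- Phi aP.1 * \sum_i asd_part u v i ^+ 2)).
  by rewrite !sum_I3 /asd_curvature /= -mulf_div divff // mul1r.
rewrite [leaf_metric _ (frame_field _ _ _) _](M u u).
rewrite [leaf_metric _ _ (frame_field aP.1 (vbasis aP.2)`_1 aP.1)](M v v).
rewrite [leaf_metric _ (frame_field _ _ _) _](M u v) sum_I3 /asd_part /=.
move: (u k0) (u k1) (u k2) (u k3) (v k0) (v k1) (v k2) (v k3) => *.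
ring.
Qed.

Lemma vbasis2 (P : {vspace V}) : \dim P = 2%N ->
  [/\ free [:: (vbasis P)`_0; (vbasis P)`_1],
      (vbasis P)`_0 \in P & (vbasis P)`_1 \in P].
Proof.
move=> dP; have fP := basis_free (vbasisP P).
have s2 : size (vbasis P) = 2%N by rewrite size_tuple.
have memP n : (n < 2)%N -> (vbasis P)`_n \in P.
  by move=> n2; apply/vbasis_mem/mem_nth; rewrite s2.
split; [|exact: memP|exact: memP].
move: fP s2 {memP}; case: (vbasis P) => s /= _.
by case: s => [|x [|y [|z s]]].
Qed.

Lemma free2P (x y : V) : free [:: x; y] <->
  forall c d : R, c *: x + d *: y = 0 -> c = 0 /\ d = 0.
Proof.
have sE (f : 'I_2 -> R) : \sum_i f i *: [tuple x; y]`_i = f 0 *: x + f 1 *: y.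
  rewrite big_ord_recl big_ord_recl big_ord0 addr0 /=; congr (_ + f _ *: _).
  exact: val_inj.
split=> [/(@freeP _ _ 2 [tuple x; y]) F c d e|F].
  have := F (fun i : 'I_2 => if i == 0 then c else d).
  by rewrite sE /= => /(_ e) f0; split; [exact: (f0 0)|exact: (f0 1)].
apply/(@freeP _ _ 2 [tuple x; y]) => f; rewrite sE => /F[f0 f1] i.
by case: i => [[|[|i]] hi] //; [rewrite -f0|rewrite -f1]; congr (f _); apply: val_inj.
Qed.

Lemma span2P (x y u : V) : u \in <<[:: x; y]>>%VS ->
  exists c d : R, u = c *: x + d *: y.
Proof.
rewrite span_cons span_seq1 => /memv_addP[_ /vlineP[c ->] [_ /vlineP[d ->] ->]].
by exists c, d.
Qed.

(** The canonical basis of the plane of V_0 and V_k is not known explicitly, but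
    its coordinates can be nonzero only on V_0 and V_k, and they form an
    invertible matrix. *)
Lemma vbasis_frame_plane a k : N a -> k != k0 ->
  let aP := (a, <<[:: (frame a)`_k0; (frame a)`_k]>>%VS) in
  [/\ Gr2 q r aP,
      forall n i, (n < 2)%N -> i != k0 -> i != k -> basis_coord aP n i = 0 &
      basis_coord aP 0 k0 * basis_coord aP 1 k
        - basis_coord aP 0 k * basis_coord aP 1 k0 != 0].
Proof.
move=> Na kk0; set x := (frame a)`_k0; set y := (frame a)`_k => aP.
have fE : free (frame a) := frame_freeP (leaf_Phi_neq0 Na).
have cE c d i : coord (frame a) i (c *: x + d *: y) = c * (i == k0)%:R + d * (i ==
  k)%:R.
  by rewrite linearD !linearZ /= /x /y !coord_free // ![_ == i]eq_sym.
have fxy : free [:: x; y].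
  apply/free2P => c d e; have := cE c d k0; have := cE c d k.
  rewrite e !linear0 !eqxx (negPf kk0) eq_sym (negPf kk0) !(mulr0, mulr1, addr0,
    add0r).
  by move=> <- <-.
have dP : \dim <<[:: x; y]>> = 2%N by apply/eqP; exact: fxy.
have [fuv /span2P[u0 [uk uE]] /span2P[v0 [vk vE]]] := vbasis2 dP.
have bE : [/\ basis_coord aP 0 k0 = u0, basis_coord aP 0 k = uk,
    basis_coord aP 1 k0 = v0 & basis_coord aP 1 k = vk].
  by rewrite /basis_coord /= uE vE !cE !eqxx (negPf kk0) eq_sym (negPf kk0)
    !(mulr0, mulr1, addr0, add0r).
split.
- split=> // u /span2P[c [d ->]].
  rewrite (_ : _ + _ = \sum_i (c * (i == k0)%:R + d * (i == k)%:R) *: (frame a)`_i).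
    exact: leaf_frame_tangent.
  rewrite (bigD1 k0) //= (bigD1 k) //= big1 => [|i /andP[/negPf -> /negPf ->]].
    by rewrite !eqxx (negPf kk0) eq_sym (negPf kk0) !(mulr0, mulr1, addr0, add0r).
  by rewrite !mulr0 addr0 scale0r.
- move=> [|[|n]] i // _ /negPf i0 /negPf ik; rewrite /basis_coord /= ?uE ?vE cE i0 ik;
  by rewrite !mulr0 addr0.
- have [-> -> -> ->] := bE; apply/eqP => D0.
  have [vk0 uk0] : vk = 0 /\ - uk = 0.
    apply: (free2P _ _).1 fuv _ _ _; rewrite uE vE !scalerDr !scalerA addrACA
      -!scalerDl.
    have -> : vk * u0 + - uk * v0 = 0 by rewrite -D0; ring.
    have -> : vk * uk + - uk * vk = 0 by ring.
    by rewrite !scale0r addr0.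
  have [_ u00] : v0 = 0 /\ - u0 = 0.
    apply: (free2P _ _).1 fuv _ _ _; rewrite uE vE !scalerDr !scalerA addrACA
      -!scalerDl.
    have -> : v0 * u0 + - u0 * v0 = 0 by ring.
    have -> : v0 * uk + - u0 * vk = 0 by rewrite -[RHS]oppr0 -D0; ring.
    by rewrite !scale0r addr0.
  have [] : (1 : R) = 0 /\ (0 : R) = 0.
    apply: (free2P _ _).1 fuv _ _ _; rewrite uE scale0r addr0 scale1r.
    move/eqP: uk0; move/eqP: u00; rewrite !oppr_eq0 => /eqP -> /eqP ->.
    by rewrite !scale0r addr0.
  by move/eqP; rewrite oner_eq0.
Qed.

(** Only one coordinate of [asd_part] is nonzero on such a plane. *)
Lemma kappa_frame_plane1 a : N a ->
  kappa q r (a, <<[:: (frame a)`_k0; (frame a)`_k1]>>%VS)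
    = asd_curvature a o0 / - Phi a.
Proof.
move=> Na; have [_ z D0] := vbasis_frame_plane Na (isT : k1 != k0).
rewrite kappaE // !sum_I3 /asd_part /= !(z _ k2) ?(z _ k3) // !(mulr0, mul0r,
  oppr0, subr0, expr0n, addr0, add0r) /=.
rewrite ?(mulr0, addr0) -mulf_div divff ?mulr1 //; exact: expf_neq0.
Qed.

Lemma kappa_frame_plane2 a : N a ->
  kappa q r (a, <<[:: (frame a)`_k0; (frame a)`_k2]>>%VS)
    = asd_curvature a o1 / - Phi a.
Proof.
move=> Na; have [_ z D0] := vbasis_frame_plane Na (isT : k2 != k0).
rewrite kappaE // !sum_I3 /asd_part /= !(z _ k1) ?(z _ k3) // !(mulr0, mul0r,
  oppr0, subr0, expr0n, addr0, add0r) /=.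
rewrite ?(mulr0, addr0, add0r) -mulf_div divff ?mulr1 //; exact: expf_neq0.
Qed.

End Planes.

(** * Bounds on the sectional curvature *)

Section Bounds.
Variable R : realType.
Local Notation V := 'M[R]_3.

(** Lagrange's identity for a_2 x a_3 = w_1 a_1. *)
Lemma leaf_Phi_sqr (q r : R) (a : V) : leaf q r a -> Phi a ^+ 2
  = dot (row o0 a) (row o0 a) * dot (row o1 a) (row o1 a) * dot (row o2 a) (row o2 a).
Proof.
move=> Na; have [orth _ _ _] := Na; have [c0 _ _] := leaf_cross Na.
have d0 := lt0r_neq0 (leaf_dot_gt0 o0 Na).
have lag (y z : 'rV[R]_3) : dot (cross y z) (cross y z)
    = dot y y * dot z z - dot y z ^+ 2.
  by rewrite !dotE !vecE; ring.
have := lag (row o1 a) (row o2 a).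
rewrite c0 (orth o1 o2) // dotZl (dotC _ (_ *: _)) dotZl expr0n subr0 -mulrA => <-.
by rewrite /rate; field.
Qed.

(** The sectional curvature is a convex combination of the eigenvalues. *)
Lemma kappa_le (q r K : R) aP : leaf q r aP.1 ->
  (forall i, `|asd_curvature aP.1 i| <= K * - Phi aP.1) -> 0 <= K ->
  `|kappa q r aP| <= K.
Proof.
move=> Na bK K0; rewrite kappaE //.
have h0 : 0 < - Phi aP.1 by have [_ _ _] := Na; rewrite oppr_gt0.
set u := basis_coord aP 0; set v := basis_coord aP 1.
have B0 : 0 <= \sum_i asd_part u v i ^+ 2 by apply: sumr_ge0 => i _; exact: sqr_ge0.
have A0 : `|\sum_i asd_curvature aP.1 i * asd_part u v i ^+ 2|
    <= K * (- Phi aP.1 * \sum_i asd_part u v i ^+ 2).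
  apply: le_trans (ler_norm_sum _ _ _) _.
  rewrite mulrA mulr_sumr; apply: ler_sum => i _.
  by rewrite normrM [`|_ ^+ 2|]ger0_norm ?sqr_ge0 // ler_wpM2r ?sqr_ge0.
rewrite normrM normfV [`|- Phi _ * _|]ger0_norm; last by rewrite mulr_ge0 // ltW.
have [->|Bn0] := eqVneq (\sum_i asd_part u v i ^+ 2) 0.
  by rewrite mulr0 invr0 mulr0.
rewrite ler_pdivrMr // mulr_gt0 //.
by rewrite lt_def Bn0.
Qed.

(** Representatives of the orbits of the rotation group; the last sign makes Phi
    negative. *)
Definition diag_point (s0 s1 s2 : R) : V :=
  triple (\row_k (s0 * (k == o0)%:R)) (\row_k (s1 * (k == o1)%:R))
    (\row_k (- s2 * (k == o2)%:R)).

Lemma diag_pointP (s0 s1 s2 : R) : 0 < s0 -> 0 < s1 -> 0 < s2 ->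
  let a := diag_point s0 s1 s2 in
  [/\ leaf (s0 ^+ 2 - s1 ^+ 2) (s1 ^+ 2 - s2 ^+ 2) a, Phi a = - (s0 * s1 * s2) &
      [/\ rate o0 a = - (s1 * s2 / s0), rate o1 a = - (s0 * s2 / s1) &
          rate o2 a = - (s0 * s1 / s2)]].
Proof.
move=> p0 p1 p2 a.
have n0 := lt0r_neq0 p0; have n1 := lt0r_neq0 p1; have n2 := lt0r_neq0 p2.
have PE : Phi a = - (s0 * s1 * s2).
  by rewrite /Phi !triple_rowE dotE !vecE !mxE /=; ring.
have d0 : dot (row o0 a) (row o0 a) = s0 ^+ 2.
  by rewrite !triple_rowE dotE !mxE /=; ring.
have d1 : dot (row o1 a) (row o1 a) = s1 ^+ 2.
  by rewrite !triple_rowE dotE !mxE /=; ring.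
have d2 : dot (row o2 a) (row o2 a) = s2 ^+ 2.
  by rewrite !triple_rowE dotE !mxE /=; ring.
split=> //; last by rewrite /rate PE d0 d1 d2; split; field.
split; rewrite ?d0 ?d1 ?d2 ?PE ?oppr_lt0 ?mulr_gt0 //.
do 2! apply: forall_I3; rewrite ?triple_rowE //= dotE !mxE /= => _; ring.
Qed.

Lemma flat_kappa aP : leaf 0 0 aP.1 -> kappa (0 : R) 0 aP = 0.
Proof.
move=> Na; have [_ /eqP e01 /eqP e12 _] := Na.
move: e01 e12; rewrite !subr_eq0 => /eqP e01 /eqP e12.
rewrite kappaE // big1 ?mul0r // => i _.
rewrite (_ : asd_curvature _ _ = 0) ?mul0r //.
move: i; apply: forall_I3; rewrite /asd_curvature /rate_curvature /rate /= e01 e12;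
  by move: (Phi _ / _) => w; field.
Qed.

(** The witnesses are s = |a_1| and x = |a_2|^2 = |a_3|^2, in terms of which
    s^2 = x + q and the rates are - x / s, - s, - s. *)
Lemma asd_curvature_EH (q : R) (a : V) : 0 < q -> leaf q 0 a ->
  exists s x, [/\ 0 < x, Num.sqrt q <= s, - Phi a = x * s
    & let c := x * q / s ^+ 2 in
      [/\ asd_curvature a o0 = c, asd_curvature a o1 = - (c / 2)
        & asd_curvature a o2 = - (c / 2)]].
Proof.
move=> q0 Na; have [_ e0 /eqP e1 P0] := Na.
have x0 := leaf_dot_gt0 o1 Na; have y0 := leaf_dot_gt0 o0 Na.
have P2 := leaf_Phi_sqr Na.
move: e1 e0; rewrite subr_eq0 => /eqP e1 e0.
exists (Num.sqrt (dot (row o0 a) (row o0 a))), (dot (row o1 a) (row o1 a)).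
move: P2; rewrite /asd_curvature /rate_curvature /rate /= -e1.
have := sqrtr_gt0 (dot (row o0 a) (row o0 a)); rewrite y0.
have := sqr_sqrtr (ltW y0).
have -> : Num.sqrt q <= Num.sqrt (dot (row o0 a) (row o0 a)) by rewrite ler_sqrt
  //; lra.
move: (Num.sqrt _) => s; move: x0 {y0} e0.
move: (dot (row o0 a) _) (dot (row o1 a) _) => y x x0 e0 yE s0 P2.
have PE : Phi a = - (x * s).
  have /eqP : Phi a ^+ 2 = (x * s) ^+ 2 by rewrite P2 exprMn yE; ring.
  rewrite eqf_sqr => /orP[/eqP PE|/eqP//].
  by move: P0; rewrite PE ltNge mulr_ge0 // ltW.
have qE : q = s ^+ 2 - x by rewrite yE; lra.
have sn0 := lt0r_neq0 s0; have xn0 := lt0r_neq0 x0.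
rewrite PE opprK -yE qE; split=> //; split; field; by rewrite ?sn0 ?xn0.
Qed.

(** The largest eigenvalue is q / s^3, and q / s^3 <= 1 / sqrt q as s >= sqrt q. *)
Lemma kappa_EH_le (q : R) aP : 0 < q -> leaf q 0 aP.1 ->
  `|kappa q 0 aP| <= 12 / Num.sqrt q.
Proof.
move=> q0 Na; have [s [x [x0 ts hE [c0 c1 c2]]]] := asd_curvature_EH q0 Na.
have t0 : 0 < Num.sqrt q by rewrite sqrtr_gt0.
have tE := sqr_sqrtr (ltW q0).
have K0 : 0 <= 12 / Num.sqrt q by rewrite divr_ge0 // ltW.
apply: kappa_le => //.
rewrite hE; move: c0 c1 c2; rewrite -[X in _ * X / _]tE.
move: (Num.sqrt q) t0 ts {tE hE} => t t0 ts; set c := x * _ / _ => c0 c1 c2.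
have s0 : 0 < s by exact: lt_le_trans ts.
have cp : 0 <= c by rewrite /c divr_ge0 ?mulr_ge0 ?sqr_ge0 // ltW.
have cK : c <= 12 / t * (x * s).
  rewrite /c ler_pdivrMr ?exprn_gt0 // -[leRHS](_ : 12 * x * s ^+ 3 / t = _); last
    first.
    by field; exact: lt0r_neq0.
  rewrite ler_pdivlMr //.
  have ts3 : t ^+ 3 <= s ^+ 3 by rewrite lerXn2r // nnegrE ltW.
  have s30 : 0 <= s ^+ 3 by rewrite exprn_ge0 // ltW.
  rewrite (_ : x * t ^+ 2 * t = x * t ^+ 3); last by ring.
  by rewrite [12 * x]mulrC -mulrA ler_pM2l //; lra.
apply: forall_I3; rewrite ?c0 ?c1 ?c2 ?normrN ger0_norm //; lra.
Qed.

(** At any point, the planes of V_0, V_1 and of V_0, V_2 have curvatures of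
    opposite signs. *)
Lemma kappa_EH_nonconstant (q : R) : 0 < q ->
  exists P P', [/\ Gr2 q 0 P, Gr2 q 0 P' & kappa q 0 P != kappa q 0 P'].
Proof.
move=> q0; have s0 : 0 < Num.sqrt (1 + q) by rewrite sqrtr_gt0; lra.
have [Na _ _] := diag_pointP s0 ltr01 ltr01.
move: Na; rewrite sqr_sqrtr; last by lra.
rewrite expr1n subrr addrAC subrr add0r; set a := diag_point _ _ _ => Na.
exists (a, <<[:: (frame a)`_k0; (frame a)`_k1]>>%VS),
  (a, <<[:: (frame a)`_k0; (frame a)`_k2]>>%VS).
split; [by have [] := vbasis_frame_plane Na (isT : k1 != k0)|
  by have [] := vbasis_frame_plane Na (isT : k2 != k0)|].
rewrite (kappa_frame_plane1 Na) (kappa_frame_plane2 Na).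
have [s [x [x0 ts hE [-> -> _]]]] := asd_curvature_EH q0 Na.
have sp : 0 < s by apply: lt_le_trans ts; rewrite sqrtr_gt0.
have h0 : 0 < x * s by exact: mulr_gt0.
have c0 : 0 < x * q / s ^+ 2 by rewrite divr_gt0 ?mulr_gt0 ?exprn_gt0.
apply/eqP => /(congr1 ( *%R^~ (x * s))); rewrite hE !divfK ?lt0r_neq0 //; lra.
Qed.

(** The left-hand side is the contribution of (w_2 - w_3)^2 when s0 = s1; the
    remaining terms of the eigenvalue are nonnegative since y, s1 <= s0. *)
Lemma kappa_diag_ge (s0 s1 y r : R) (a := diag_point s0 s1 y) :
  0 < y -> 0 < r -> s1 ^+ 2 = y ^+ 2 + r -> 0 < s1 -> s1 <= s0 ->
  r ^+ 2 / (2 * y ^+ 3 * (y ^+ 2 + r)) <= asd_curvature a o0 / - Phi a.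
Proof.
move=> y0 r0 s1E s10 s10'.
have s00 : 0 < s0 by exact: lt_le_trans s10'.
have n0 := lt0r_neq0 s00; have n1 := lt0r_neq0 s10; have n2 := lt0r_neq0 y0.
have [_ PE [w0 w1 w2]] := diag_pointP s00 s10 y0.
rewrite /asd_curvature /rate_curvature /= w0 w1 w2 PE -s1E opprK.
have rE : r = s1 ^+ 2 - y ^+ 2 by lra.
have s2 : s1 ^+ 2 <= s0 ^+ 2 by rewrite lerXn2r // nnegrE ltW.
have ys : y ^+ 2 <= s0 ^+ 2 by lra.
rewrite -subr_ge0.
rewrite [X in 0 <= X](_ : _ = r ^+ 2 * (s0 - s1) / (2 * y ^+ 3 * s1 ^+ 3)
  + (y ^+ 2 * (s0 ^+ 2 - s1 ^+ 2) + s1 ^+ 2 * (s0 ^+ 2 - y ^+ 2))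
    / (2 * s0 ^+ 3 * s1 * y)); last first.
  by rewrite rE; field; rewrite n0 n1 n2.
have P k (z : R) : 0 < z -> 0 < z ^+ k by exact: exprn_gt0.
have p2 : (0 : R) < 2 by [].
apply: addr_ge0; apply: divr_ge0.
- by rewrite mulr_ge0 ?sqr_ge0 // subr_ge0.
- by rewrite ltW // !mulr_gt0 // P.
- by rewrite addr_ge0 // mulr_ge0 ?sqr_ge0 // subr_ge0.
- by rewrite ltW // !mulr_gt0 // P.
Qed.

(** The lower bound of [kappa_diag_ge] grows like y^-3 when the length y of the
    third row tends to 0. *)
Lemma kappa_unbounded (q r M : R) : 0 <= q -> 0 < r ->
  exists P, Gr2 q r P /\ M < `|kappa q r P|.
Proof.
move=> q0 r0; pose K := 2 * (1 + r) * (`|M| + 1).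
have r20 : 0 < r ^+ 2 by rewrite exprn_gt0.
have K0 : 0 < K by rewrite /K !mulr_gt0 //; have := normr_ge0 M; lra.
(* Chosen so that y <= 1 and K * y < r ^+ 2; with y <= 1, the denominator of the
   lower bound is at most 2 * y * (1 + r). *)
pose y := r ^+ 2 / (K + r ^+ 2).
have d0 : 0 < K + r ^+ 2 by lra.
have y0 : 0 < y by rewrite /y divr_gt0.
have y1 : y <= 1 by rewrite /y ler_pdivrMr //; lra.
have lt1 : (`|M| + 1) * (2 * y * (1 + r)) < r ^+ 2.
  rewrite [X in X < _](_ : _ = K * y); last by rewrite /K; ring.
  rewrite /y mulrA ltr_pdivrMr // mulrDr [r ^+ 2 * K]mulrC ltrDl.
  by rewrite mulr_gt0.
clearbody y.
pose s1 := Num.sqrt (y ^+ 2 + r); pose s0 := Num.sqrt (y ^+ 2 + r + q).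
have y20 : 0 < y ^+ 2 by rewrite exprn_gt0.
have s1E : s1 ^+ 2 = y ^+ 2 + r by rewrite sqr_sqrtr //; lra.
have s0E : s0 ^+ 2 = y ^+ 2 + r + q by rewrite sqr_sqrtr //; lra.
have s10 : 0 < s1 by rewrite sqrtr_gt0; lra.
have s01 : s1 <= s0 by rewrite ler_sqrt; lra.
have [Na _ _] := diag_pointP (lt_le_trans s10 s01) s10 y0.
have ge := kappa_diag_ge y0 r0 s1E s10 s01.
move: Na ge; set a := diag_point _ _ _ => Na ge.
have {}Na : leaf q r a.
  by move: Na; rewrite s0E s1E addrAC subrr add0r addrAC subrr add0r.
exists (a, <<[:: (frame a)`_k0; (frame a)`_k1]>>%VS); split.
  by have [] := vbasis_frame_plane Na (isT : k1 != k0).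
rewrite (kappa_frame_plane1 Na).
apply: lt_le_trans (ler_norm _); apply: lt_le_trans ge.
apply: le_lt_trans (ler_norm M) _.
have yr0 : 0 < y ^+ 2 + r by lra.
have yn : y ^+ 2 <= 1 by rewrite expr_le1 // ltW.
have y3 : y ^+ 3 <= y by rewrite exprS ler_piMr // ltW.
rewrite ltr_pdivlMr; last by rewrite !mulr_gt0 // exprn_gt0.
apply: le_lt_trans lt1; apply: ler_pM.
- exact: normr_ge0.
- by rewrite !mulr_ge0 // ?exprn_ge0 // ltW.
- by lra.
- rewrite -[leLHS]mulrA -[leRHS]mulrA ler_pM2l //; apply: ler_pM => //.
  + by rewrite exprn_ge0 // ltW.
  + exact: ltW.
  + by lra.
Qed.

End Bounds.

Theorem theorem4p1 (R : realType) :
  [/\ (* (i) *)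
      forall P, Gr2 0 0 P -> @kappa R 0 0 P = 0,
      (* (ii) *)
      forall q : R, 0 < q ->
        (exists P P', [/\ Gr2 q 0 P, Gr2 q 0 P' & kappa q 0 P != kappa q 0 P'])
        /\ (forall P, Gr2 q 0 P -> `|kappa q 0 P| <= 12 / Num.sqrt q)
    & (* (iii) *)
      forall q r : R, 0 <= q -> 0 < r ->
        forall M : R, exists P, Gr2 q r P /\ M < `|kappa q r P|].
Proof.
split=> [P [NP _ _]|q q0|q r q0 r0 M].
- exact: flat_kappa.
- by split=> [|P [NP _ _]]; [exact: kappa_EH_nonconstant|exact: kappa_EH_le].
- exact: kappa_unbounded.
Qed.
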